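(* Let $(\mathbf{P},\mathbf{F})\sim SMBS(\mathbf{m},\mathbf{c},\mathbf{F_0})$ and, conditionally on $(\mathbf{P},\mathbf{F})$, let $S=(S_t)_{t\ge0}\sim SM(\mathbf{P},\mathbf{F})$ (started at the fixed state $l_0$). Put $x(t)=l(t)+1$ for all integers $t\ge 0$. Then for all integers $t\geq 0$, $\mathbb{P}(S_{t+1}=\cdot\mid S_{0:t})=k_t(S_{0:t};\cdot)$, where, if $S_t=i\neq j$, $$k_t(S_{0:t};i)= \frac{c^{i}(x(t))F_0^i((x(t),+\infty))+N^{i,t}((x(t),+\infty))}{c^i(x(t))F_0^i([x(t),+\infty))+N^{i,t}([x(t),+\infty))},$$ $$k_t(S_{0:t};j)= \frac{c^i(x(t))F_0^i(\{x(t)\})+N^{i,t}(\{x(t)\})}{c^i(x(t))F_0^i([x(t),+\infty))+N^{i,t}([x(t),+\infty))} \cdot \frac{m^i(\{j\})+M^{i,j}(t)}{m^i(E)+\sum_{h\neq i} M^{i,h}(t)}.$$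
   Context: $E$ is a non-empty finite or countably infinite set, with a fixed element $l_0\in E$. $I\{\cdot\}$ denotes an indicator. $x_{a:b}=(x_a,\dots,x_b)$ if $a\le b$, and the empty sequence if $a>b$. A non-decreasing function on the integers and its associated measure are denoted by the same symbol; e.g. $F(x)=F((-\infty,x])$, and $(a,b]$ denotes a set of integers. Empty sums are $0$ and empty products are $1$. Semi-Markov processes. A characteristic couple is a pair $(\mathbf{P},\mathbf{F})$ where $\mathbf{P}=(P^{i,j})_{i,j\in E}$ is a transition matrix on $E$ with $P^{i,i}=0$ for all $i$, and $\mathbf{F}=(F^i)_{i\in E}$ is a collection of probability distributions on the positive integers. The $i$-th row of $\mathbf{P}$ is identified with the probability measure $P^i(\{j\})=P^{i,j}$ on $E$. A Markov renewal process starting at $l_0$ with characteristic couple $(\mathbf{P},\mathbf{F})$ is a process $(L_n,T_n)_{n\ge 0}$ with $L_0=l_0$ a.s. and $$\mathbb{P}(L_{n+1}=j,T_n\le t\mid L_n=i,L_{0:n-1},T_{0:n-1},(\mathbf{P},\mathbf{F}))=F^i(t)P^{i,j}$$ for all $n\ge0$, $t\ge1$, $i,j\in E$. With $\tau_0=0$, $\tau_{n+1}=\sum_{h=0}^nT_h$ and $N(t)=\sum_{n\ge1}I\{\tau_n\le t\}$, the process $S_t=L_{N(t)}$, $t=0,1,2,\dots$, is the associated semi-Markov process, written $S\sim SM(\mathbf{P},\mathbf{F})$. Beta-Stacy process. Given $c(t)>0$ for all integers $t>0$ and a probability distribution $F_0$ with support on the positive integers, a random distribution $F$ is $BS(c,F_0)$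 if there are independent random variables $(U_t)_{t\ge1}$ with $U_t\sim Beta(c(t)F_0(\{t\}),c(t)F_0((t,+\infty)))$ and $F((t,+\infty))=\prod_{k=1}^t(1-U_k)$ for all integers $t\ge0$. It is assumed that $F_0((t,+\infty))>0$ for all $t\ge 0$, and $Beta(0,b)$ with $b>0$ is read as the point mass at $0$. Dirichlet process. For a measure $m$ on $E$ with $0<m(E)<\infty$, a random probability measure $P$ on $E$ is $Dir(m)$ if $(P(A_1),\dots,P(A_n))\sim Dirichlet(m(A_1),\dots,m(A_n))$ for every finite partition $A_1,\dots,A_n$ of $E$ (coordinates with zero parameter are a.s. $0$). Semi-Markov beta-Stacy process. For each $i\in E$ let $m^i$ be a measure on $E$ with $0<m^i(E)<\infty$ and $m^i(\{i\})=0$, let $c^i(t)>0$ for all integers $t>0$, and let $F_0^i$ be a distribution with support on the positive integers; put $\mathbf{m}=(m^i)_{i\in E}$, $\mathbf{c}=(c^i)_{i\in E}$, $\mathbf{F_0}=(F_0^i)_{i\in E}$. A random characteristic couple satisfies $(\mathbf{P},\mathbf{F})\sim SMBS(\mathbf{m},\mathbf{c},\mathbf{F_0})$ if: $\mathbf{P}$ and $\mathbf{F}$ are independent; the rows $P^i$, $i\in E$, are independent; the $F^i$, $i\in E$, are independent; $P^i\sim Dir(m^i)$ for all $i$; and $F^i\sim BS(c^i,F_0^i)$ for all $i$. Path statistics of $S_{0:t}$. $l(t)=\max\{k\in\{0,\dots,t\}:S_t=S_{t-1}=\cdots=S_{t-k}\}$. For $i\ne j$, $M^{i,j}(t)=\sum_{k=1}^tI\{S_{k-1}=i,S_k=j\}$.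 $N^{i,t}(l)=\sum_{k=0}^{N(t)-1}I\{T_k\le l,L_k=i\}$ is the number of completed (uncensored) visits to $i$ in $S_{0:t}$ of length at most $l$; as a measure, $N^{i,t}(A)$ is the number of completed visits to $i$ in $S_{0:t}$ with length in $A$. The equality of conditional probabilities is understood almost surely. *)

(* Defs.v *)
From HB Require Import structures.
From mathcomp Require Import all_boot all_order all_algebra.
From mathcomp Require Import finmap.
From mathcomp Require Import all_classical all_reals all_analysis.
From mathcomp Require Import measurable_realfun.
Set Implicit Arguments.
Unset Strict Implicit.
Unset Printing Implicit Defensive.
Import Order.TTheory GRing.Theory Num.Theory.
Import numFieldNormedType.Exports.
Local Open Scope classical_set_scope.
Local Open Scope ring_scope.

(** * Generated sigma-algebras, independence, conditional probability *)

Definition events {O : Type} {d} {U : measurableType d} (X : O -> U) :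
    set (set O) :=
  preimage_set_system [set: O] X measurable.

(** A random probability measure is a probability kernel; its sigma-algebra is
    generated by the evaluations [w |-> K w A]. *)
Definition random_measure_events {d d'} {O : measurableType d}
    {U : measurableType d'} {R : realType} (K : R.-pker O ~> U) :
    set (set O) :=
  \bigcup_(A in @measurable _ U) events (fun w : O => K w A).

Definition mutually_independent {d} {O : measurableType d} {R : realType}
    (Pr : probability O R) (I : choiceType) (G : I -> set (set O)) : Prop :=
  forall (J : {fset I}) (A : I -> set O),
    (forall i, i \in J -> G i (A i)) ->
    Pr (\bigcap_(i in [set` J]) A i) = (\prod_(i <- J) Pr (A i))%E.

(** [cond_prob_eq Pr G A f] : "P(A | G) = f almost surely", that is, [f] is a.s.
    equal to a version [g] of the conditional probability of [A] given the
    sub-sigma-algebra [G]. *)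
Definition cond_prob_eq {d} {O : measurableType d} {R : realType}
    (Pr : probability O R) (G : set (set O)) (A : set O) (f : O -> R) : Prop :=
  exists g : O -> R,
    [/\ forall B : set R, measurable B -> G (g @^-1` B),
        Pr.-integrable [set: O] (EFin \o g),
        forall B : set O, G B ->
          (\int[Pr]_(w in B) (g w)%:E = Pr (A `&` B))%E
      & {ae Pr, forall w, f w = g w}].

(** * Beta, gamma and Dirichlet distributions *)

Definition normalized_density_law {R : realType} (f : R -> R) (A : set R) :
    \bar R :=
  (fine (\int[@lebesgue_measure R]_(x in A) (f x)%:E) /
   fine (\int[@lebesgue_measure R]_x (f x)%:E))%:E.

Definition beta_law {R : realType} (a b : R) (A : set R) : \bar R :=
  if a == 0 then dirac (0 : R) A
  else normalized_density_law
    (fun x => if 0 < x < 1 then x `^ (a - 1) * (1 - x) `^ (b - 1) else 0) A.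

Definition gamma_law {R : realType} (a : R) (A : set R) : \bar R :=
  if a == 0 then dirac (0 : R) A
  else normalized_density_law
    (fun x => if 0 < x then x `^ (a - 1) * expR (- x) else 0) A.

Definition has_law {d} {O : measurableType d} {R : realType}
    (Pr : probability O R) (X : {RV Pr >-> R}) (mu : set R -> \bar R) : Prop :=
  forall A : set R, measurable A -> distribution Pr X A = mu A.

(** Ferguson's definition: Dirichlet(a_1, ..., a_n) is the law of
    (Z_1, ..., Z_n) / (Z_1 + ... + Z_n) for independent Z_k ~ Gamma(a_k, 1),
    with Z_k = 0 a.s. when a_k = 0. *)
Definition is_dirichlet {R : realType} (n : nat) (a : 'I_n -> R)
    (mu : set (n.-tuple R) -> \bar R) : Prop :=
  exists (d : measure_display) (O : measurableType d) (Q : probability O R)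
         (Z : 'I_n -> {RV Q >-> R}),
    [/\ mutually_independent Q (fun k => events (Z k)),
        forall k, has_law (Z k) (gamma_law (a k))
      & forall B : set (n.-tuple R), measurable B ->
          mu B = Q [set w | B [tuple Z k w / \sum_(j < n) Z j w | k < n]]].

(** * Dirichlet and beta-Stacy processes *)

Definition dirichlet_process {d d'} {O : measurableType d}
    {E : measurableType d'} {R : realType} (Pr : probability O R)
    (p : R.-pker O ~> E) (m : {measure set E -> \bar R}) : Prop :=
  forall (n : nat) (A : 'I_n -> set E), partition [set: 'I_n] A [set: E] ->
    is_dirichlet (fun k => fine (m (A k)))
      (fun B => Pr [set w | B [tuple fine (p w (A k)) | k < n]]).

Definition beta_stacy {d} {O : measurableType d} {R : realType}
    (Pr : probability O R) (f : R.-pker O ~> nat)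
    (c : nat -> R) (F0 : probability nat R) : Prop :=
  (* [U 0] is unused *)
  exists U : nat -> {RV Pr >-> R},
    [/\ mutually_independent Pr (fun t => events (U t.+1)),
        forall t : nat, (0 < t)%N ->
          has_law (U t) (beta_law (c t * fine (F0 [set t]))
                                  (c t * fine (F0 [set s | (t < s)%N])))
      & {ae Pr, forall w, forall t : nat,
          f w [set s | (t < s)%N] = (\prod_(1 <= k < t.+1) (1 - U k w))%:E}].

(** * Semi-Markov beta-Stacy process *)

Definition characteristic_couple {d d'} {O : measurableType d}
    {E : measurableType d'} {R : realType}
    (P : E -> R.-pker O ~> E) (F : E -> R.-pker O ~> nat) : Prop :=
  forall (w : O) (i : E), P i w [set i] = 0%E /\ F i w [set 0%N] = 0%E.

Definition smbs {d d'} {O : measurableType d} {E : measurableType d'}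
    {R : realType} (Pr : probability O R)
    (P : E -> R.-pker O ~> E) (F : E -> R.-pker O ~> nat)
    (m : E -> {measure set E -> \bar R}) (c : E -> nat -> R)
    (F0 : E -> probability nat R) : Prop :=
  [/\ characteristic_couple P F,
      forall A B : set O,
        <<s \bigcup_i random_measure_events (P i) >> A ->
        <<s \bigcup_i random_measure_events (F i) >> B ->
        (Pr (A `&` B) = Pr A * Pr B)%E,
      mutually_independent Pr (fun i => <<s random_measure_events (P i) >>)
      /\ mutually_independent Pr (fun i => <<s random_measure_events (F i) >>),
      forall i, dirichlet_process Pr (P i) (m i)
    & forall i, beta_stacy Pr (F i) (c i) (F0 i)].

(** * Markov renewal and semi-Markov processes *)

(** sigma-algebra of ((P, F), L_{0:n}, T_{0:n-1}) *)
Definition renewal_history {d d'} {O : measurableType d}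
    {E : measurableType d'} {R : realType} (Pr : probability O R)
    (P : E -> R.-pker O ~> E) (F : E -> R.-pker O ~> nat)
    (L : nat -> {RV Pr >-> E}) (T : nat -> {RV Pr >-> nat}) (n : nat) :
    set (set O) :=
  <<s (\bigcup_i random_measure_events (P i))
      `|` (\bigcup_i random_measure_events (F i))
      `|` (\bigcup_(k in [set k | (k <= n)%N]) events (L k))
      `|` (\bigcup_(k in [set k | (k < n)%N]) events (T k)) >>.

(** Markov renewal process, conditionally on the random couple (P, F); the
    right-hand side equals F^i(t) P^{i,j} on the event {L_n = i}. *)
Definition markov_renewal {d d'} {O : measurableType d}
    {E : measurableType d'} {R : realType} (Pr : probability O R) (l0 : E)
    (P : E -> R.-pker O ~> E) (F : E -> R.-pker O ~> nat)
    (L : nat -> {RV Pr >-> E}) (T : nat -> {RV Pr >-> nat}) : Prop :=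
  [/\ forall n w, (0 < T n w)%N,
      {ae Pr, forall w, L 0%N w = l0}
    & forall (n t : nat) (j : E), (0 < t)%N ->
        cond_prob_eq Pr (renewal_history P F L T n)
          [set w | L n.+1 w = j /\ (T n w <= t)%N]
          (fun w => fine (F (L n w) w [set s | (s <= t)%N])
                    * fine (P (L n w) w [set j]))].

(** In the following definitions [L] and [T] are single trajectories of the
    states and of the holding times. *)

Definition jump_time (T : nat -> nat) (n : nat) : nat := (\sum_(h < n) T h)%N.

(** The sum over all n >= 1 has finite support because holding times are
    positive. *)
Definition num_jumps (T : nat -> nat) (t : nat) : nat :=
  \big[addn/0%N]_(n \in [set n | (1 <= n)%N]) ((jump_time T n <= t)%N : nat).

Definition semi_markov {E : Type} (L : nat -> E) (T : nat -> nat) (t : nat) :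
    E :=
  L (num_jumps T t).

(** l(t) *)
Definition backward_time {E : eqType} (S : nat -> E) (t : nat) : nat :=
  (\max_(k < t.+1 | [forall h : 'I_k.+1, S (t - h)%N == S t]) k)%N.

(** M^{i,j}(t) *)
Definition num_transitions {E : eqType} (S : nat -> E) (i j : E) (t : nat) :
    nat :=
  (\sum_(1 <= k < t.+1) ((S k.-1 == i) && (S k == j)))%N.

(** N^{i,t}(A) *)
Definition num_completed_visits {E : eqType} (L : nat -> E) (T : nat -> nat)
    (i : E) (t : nat) (A : set nat) : nat :=
  (\sum_(k < num_jumps T t) ((T k \in A) && (L k == i)))%N.

(** * Predictive kernel *)

Definition smbs_predictive {d} {E : measurableType d} {R : realType}
    (m : E -> {measure set E -> \bar R}) (c : E -> nat -> R)
    (F0 : E -> probability nat R)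
    (L : nat -> E) (T : nat -> nat) (t : nat) (j : E) : R :=
  let S := semi_markov L T in
  let i := S t in
  let x := (backward_time S t).+1 in
  let F0i A : R := fine (F0 i A) in
  let N A : R := (num_completed_visits L T i t A)%:R in
  let M h := num_transitions S i h t in
  let den := c i x * F0i [set s | (x <= s)%N] + N [set s | (x <= s)%N] in
  if j == i then
    (c i x * F0i [set s | (x < s)%N] + N [set s | (x < s)%N]) / den
  else
    (c i x * F0i [set x] + N [set x]) / den
    * ((fine (m i [set j]) + (M j)%:R)
       / (fine (m i [set: E])
          + (\big[addn/0%N]_(h \in [set h | h != i]) M h)%:R)).

(* Main.v *)
(** On the almost sure event that consecutive renewal states differ, S_{0:t} takes
    countably many values, and the event that it takes a given one fixes
    L_0, ..., L_n and T_0, ..., T_{n-1} together with the bound T_n > y, where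
    n = N(t) and y = l(t).  Conditionally on (P, F) the probability of such an
    event is a product of factors F^i({s}), one F^i((y, oo)) and factors P^{i,j};
    taking the expectation, the independence of P, F and of their rows leaves, for
    the current state i, one moment of F^i and one moment of P^i.  Prolonging the
    path by one step modifies only these two moments, and the quotient is given
    by two urn identities.  For P^i, written as normalized gamma variables Z_k / G,
    the identity follows from the recurrence of the gamma moments under the
    Laplace transform in G.  For F^i, independence of the sticks U_t reduces it
    to the recurrence of the moments of a single beta variable, an integration
    by parts. *)

Require Import Defs.
From mathcomp Require Import all_boot all_order all_algebra finmap.
From mathcomp Require Import all_classical all_reals all_analysis.
From mathcomp Require Import measurable_realfun.
From mathcomp Require Import ring zify.
Import Order.TTheory GRing.Theory Num.Theory.
Import numFieldNormedType.Exports.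
Local Open Scope classical_set_scope.
Local Open Scope ring_scope.

Set Implicit Arguments.
Unset Strict Implicit.
Unset Printing Implicit Defensive.

(** Everything is kept multiplied out and in [[0, +oo]]. A history may have probability zero, so a
    predictive probability appears as a proportionality between the probabilities of two path
    events. The moments are integrals of nonnegative functions, and normalizing constants as well as
    the contributions of the other rows are common factors of both sides, so no gamma or beta
    function is ever evaluated. The remaining difficulty is measurability. The kernel reads the
    completed visits off [L] and [T], and these counts are determined by [S_{0:t}] only if no jump
    leads from a state to itself, which holds almost surely but not everywhere. The version of the
    conditional probability is therefore computed from [S] alone, while probabilities are computed
    on cells described by the renewal data. Since [E] is countable, membership in the sigma-algebra
    of [S_{0:t}] amounts to invariance under changes of [w] that leave [S_{0:t}] fixed, and every
    such invariant set is a union of cells, of which there are countably many. *)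

Section integral_agree.
Context d1 d2 d (O1 : measurableType d1) (O2 : measurableType d2)
  (T : measurableType d) (R : realType).
Variables (mu1 : {measure set O1 -> \bar R}) (mu2 : {measure set O2 -> \bar R}).
Local Open Scope ereal_scope.

Import HBNNSimple.

Lemma integral_nnsfun_comp d' (O' : measurableType d')
    (mu : {measure set O' -> \bar R})
    (phi : O' -> T) (Y : O' -> \bar R) (f : {nnsfun T >-> R}) :
  measurable_fun setT phi -> measurable_fun setT Y -> (forall w, 0 <= Y w) ->
  \int[mu]_w ((f (phi w))%:E * Y w) =
  \sum_(r \in range f) (r%:E * \int[mu]_w ((\1_(f @^-1` [set r]) (phi w))%:E * Y w)).
Proof.
move=> mphi mY Y0.
have mI r : measurable_fun setT
    (fun w => (\1_(f @^-1` [set r]) (phi w))%:E * Y w).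
  apply: emeasurable_funM => //; apply/measurable_EFinP.
  exact: measurableT_comp.
have I0 r w : 0 <= (\1_(f @^-1` [set r]) (phi w))%:E * Y w.
  by rewrite mule_ge0// lee_fin.
transitivity (\int[mu]_w (\sum_(r \in range f)
    (r%:E * ((\1_(f @^-1` [set r]) (phi w))%:E * Y w)))).
  apply: eq_integral => w _.
  rewrite fimfunE -fsumEFin// ge0_mule_fsuml//; last first.
    by move=> r; rewrite nnfun_muleindic_ge0.
  by apply: eq_fsbigr => r _; rewrite EFinM muleA.
have rI0 r w : 0 <= r%:E * ((\1_(f @^-1` [set r]) (phi w))%:E * Y w).
  by rewrite muleA mule_ge0// -EFinM nnfun_muleindic_ge0.
rewrite ge0_integral_fsum//; last by move=> r; exact: measurable_funeM.
apply: eq_fsbigr => r /[!inE] -[t _ <-].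
by rewrite ge0_integralZl// lee_fin.
Qed.

(** Both sides are additive and continuous from below in [X], so agreement on indicators passes to
    simple functions and then to limits. With two spaces and two weights, one lemma serves for
    changes of variables, independence and conditioning. *)
Lemma ge0_integral_agree (phi1 : O1 -> T) (phi2 : O2 -> T)
    (Y1 : O1 -> \bar R) (Y2 : O2 -> \bar R) (X : T -> \bar R) :
  measurable_fun setT X -> (forall x, 0 <= X x) ->
  measurable_fun setT phi1 -> measurable_fun setT phi2 ->
  measurable_fun setT Y1 -> measurable_fun setT Y2 ->
  (forall w, 0 <= Y1 w) -> (forall w, 0 <= Y2 w) ->
  (forall A, measurable A ->
     \int[mu1]_w ((\1_A (phi1 w))%:E * Y1 w) =
     \int[mu2]_w ((\1_A (phi2 w))%:E * Y2 w)) ->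
  \int[mu1]_w (X (phi1 w) * Y1 w) = \int[mu2]_w (X (phi2 w) * Y2 w).
Proof.
move=> mX X0 mphi1 mphi2 mY1 mY2 Y10 Y20 agree.
pose f := nnsfun_approx measurableT mX.
have key d' (O' : measurableType d') (mu : {measure set O' -> \bar R})
    (phi : O' -> T) (Y : O' -> \bar R) :
  measurable_fun setT phi -> measurable_fun setT Y -> (forall w, 0 <= Y w) ->
  \int[mu]_w (X (phi w) * Y w) =
  limn (fun n => \int[mu]_w ((f n (phi w))%:E * Y w)).
  move=> mphi mY Y0; rewrite -monotone_convergence//.
  - apply: eq_integral => w _; apply/esym/cvg_lim => //.
    have fX : (EFin \o f ^~ (phi w)) n @[n --> \oo] --> X (phi w).
      by apply: cvg_nnsfun_approx.
    case: (Y w) (Y0 w) => [y y0|_|//].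
      by apply: (cvgeZr (f := fun n => (f n (phi w))%:E)) => //; exact: fX.
    (* Here the weight is [+oo]. The product is not continuous at [0 * +oo]; where [X] vanishes, the
       approximations lie below it and vanish as well. *)
    have [Xw0|Xw0] := eqVneq (X (phi w)) 0; last first.
      apply: (cvgeM (f := fun n => (f n (phi w))%:E) (g := cst +oo));
        [|exact: fX|exact: cvg_cst].
      by rewrite mule_defE (negbTE Xw0).
    suff fn0 n : f n (phi w) = 0%R.
      by under eq_fun do rewrite fn0 mul0e; rewrite Xw0 mul0e; exact: cvg_cst.
    apply/eqP; rewrite eq_le fun_ge0 andbT -lee_fin.
    rewrite -[0%R%:E]/(0 : \bar R) -{1}Xw0 /f nnsfun_approxE.
    exact: le_approx.
  - move=> n; apply: emeasurable_funM => //; apply/measurable_EFinP.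
    exact: measurableT_comp.
  - by move=> n w _; rewrite mule_ge0// lee_fin.
  - move=> w _ m n mn; rewrite lee_wpmul2r// lee_fin.
    exact/lefP/nd_nnsfun_approx.
rewrite !key//; congr (limn _); apply/funext => n.
rewrite !integral_nnsfun_comp//.
by apply: eq_fsbigr => r _; rewrite agree.
Qed.

End integral_agree.

(** * Expectations of products of independent variables *)

Section independence.
Context d (O : measurableType d) (R : realType) (Pr : probability O R).
Local Open Scope ereal_scope.

Lemma prode_indic (I : choiceType) (s : seq I) (A : I -> set O) w :
  \prod_(i <- s) (\1_(A i) w : R)%:E = (\1_(\bigcap_(i in [set` s]) A i) w)%:E.
Proof.
rewrite bigcap_seq.
elim: s => [|i s ih]; first by rewrite !big_nil indicT.
by rewrite !big_cons ih indicI.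
Qed.

Lemma emeasurable_prod (I : Type) (s : seq I) (f : I -> O -> \bar R) :
  (forall i, measurable_fun setT (f i)) ->
  measurable_fun setT (fun w => \prod_(i <- s) f i w).
Proof.
move=> mf; elim: s => [|i s ih].
  by under eq_fun do rewrite big_nil; exact: measurable_cst.
by under eq_fun do rewrite big_cons; exact: emeasurable_funM.
Qed.

Lemma expectation_prod (I : choiceType) (dd : I -> measure_display)
    (T : forall i, measurableType (dd i)) (phi : forall i, O -> T i)
    (X : forall i, T i -> \bar R) (s : seq I) :
  (forall i, measurable_fun setT (phi i)) ->
  mutually_independent Pr (fun i => events (phi i)) ->
  (forall i, measurable_fun setT (X i)) -> (forall i x, 0 <= X i x) ->
  uniq s ->
  \int[Pr]_w \prod_(i <- s) X i (phi i w) =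
  \prod_(i <- s) \int[Pr]_w X i (phi i w).
Proof.
move=> mphi ind mX X0.
have evm i A : events (phi i) A -> measurable A.
  by move=> [B mB <-]; exact: mphi.
have mXphi i : measurable_fun setT (fun w => X i (phi i w)).
  exact: measurableT_comp.
(* The independence hypothesis covers indicators only. Induction on [s1], the indices that carry
   general functions: [ge0_integral_agree] trades the indicator at one index for [X i]. *)
suff claim s1 s2 (A : I -> set O) : (forall i, i \in s2 -> events (phi i) (A i)) ->
    uniq (s1 ++ s2) ->
    \int[Pr]_w (\prod_(i <- s1) X i (phi i w) * \prod_(i <- s2) (\1_(A i) w)%:E) =
    \prod_(i <- s1) \int[Pr]_w X i (phi i w) * \prod_(i <- s2) Pr (A i).
  move=> us; have := claim s [::] (fun=> set0).
  rewrite cats0 big_nil mule1 => <- //.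
  by apply: eq_integral => w _; rewrite big_nil mule1.
elim: s1 s2 A => [|i s1 ih] s2 A evA us12.
  under eq_integral do rewrite big_nil mul1e prode_indic.
  rewrite big_nil mul1e integral_indic//; last first.
    by apply: fin_bigcap_measurable => [|i /= /evA /evm//]; exact: finite_seq.
  rewrite setIT.
  have -> : \prod_(i <- s2) Pr (A i) = \prod_(i <- [fset x in s2]%fset) Pr (A i).
    apply: perm_big; apply: uniq_perm => //.
    by move=> x; rewrite !inE.
  rewrite -ind; last by move=> i; rewrite !inE; exact: evA.
  by congr (Pr _); apply: eq_bigcapl; split=> x /=; rewrite !inE.
pose Y w := \prod_(j <- s1) X j (phi j w) * \prod_(j <- s2) (\1_(A j) w)%:E.
have Y0 w : 0 <= Y w.
  rewrite mule_ge0//; first exact: prode_ge0.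
  by apply: prode_ge0 => // j _; rewrite lee_fin.
have mY : measurable_fun setT Y.
  apply: emeasurable_funM; first exact: emeasurable_prod.
  elim: s2 evA {us12 Y Y0} => [|j s2 ih'] evA.
    by under eq_fun do rewrite big_nil; exact: measurable_cst.
  under eq_fun do rewrite big_cons; apply: emeasurable_funM.
    apply/measurable_EFinP/measurable_indic/(evm j)/evA; exact: mem_head.
  by apply: ih' => k ks2; apply: evA; rewrite inE ks2 orbT.
have us1 : uniq (s1 ++ s2) by move: us12 => /= /andP[].
have is12 : i \notin s1 ++ s2 by move: us12 => /= /andP[].
have EY := ih s2 A evA us1.
have agree B : measurable B ->
    \int[Pr]_w ((\1_B (phi i w))%:E * Y w) =
    \int[Pr]_w ((\1_B (phi i w))%:E * (\int[Pr]_w Y w)).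
  move=> mB.
  pose A' j := if j == i then phi i @^-1` B else A j.
  have evB : events (phi i) (phi i @^-1` B) by exists B => //; rewrite setTI.
  have A'A j : j \in s2 -> A' j = A j.
    move=> js2; rewrite /A' ifN//; apply: contraNneq is12 => <-.
    by rewrite mem_cat js2 orbT.
  have A'i : A' i = phi i @^-1` B by rewrite /A' eqxx.
  transitivity (\int[Pr]_w (\prod_(i <- s1) X i (phi i w) *
                            \prod_(i <- i :: s2) (\1_(A' i) w)%:E)).
    apply: eq_integral => w _; rewrite big_cons /Y muleCA A'i.
    by congr (_ * (_ * _)); apply: eq_big_seq => j js2; rewrite A'A.
  rewrite ih; first last.
  - by rewrite -cat_rcons -cats1 -catA uniq_catCA.
  - move=> j; rewrite inE => /predU1P[->|js2]; first by rewrite A'i.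
    by rewrite A'A//; exact: evA.
  rewrite ge0_integralZr//; [|by apply/measurable_EFinP; apply: measurableT_comp|exact: integral_ge0].
  rewrite EY muleCA big_cons A'i; congr (_ * (_ * _)).
    rewrite -[LHS]/(Pr (phi i @^-1` B)) -[in LHS](setIT (phi i @^-1` B)).
    by rewrite -integral_indic//; exact: evm evB.
  by apply: eq_big_seq => j js2; rewrite A'A.
transitivity (\int[Pr]_w (X i (phi i w) * (\int[Pr]_w Y w))).
  under eq_integral do rewrite big_cons -muleA -/(Y _).
  apply: (ge0_integral_agree (phi1 := phi i) (phi2 := phi i)) => //.
  by move=> w; exact: integral_ge0.
rewrite ge0_integralZr//; last exact: integral_ge0.
by rewrite EY big_cons muleA.
Qed.

End independence.

(** * Fundamental theorem of calculus on increasing segments *)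

Section improper_FTC.
Context {R : realType}.
Local Notation mu := (@lebesgue_measure R).

Lemma is_derive_continuous (f : R -> R) (x df : R) :
  is_derive x 1 f df -> {for x, continuous f}.
Proof.
move=> [df1 _].
by apply: differentiable_continuous; apply/derivable1_diffP.
Qed.

(* [f1] and [f2] need not be integrable: the identity also holds between
   infinite integrals. *)
Lemma ge0_improper_FTC (g f1 f2 : R -> R) (a b : nat -> R) (l : R) :
  (forall n, a n < b n) -> (forall n, a n.+1 <= a n) ->
  (forall n, b n <= b n.+1) ->
  let D := \bigcup_n [set` `[a n, b n]] in
  (forall x, D x -> is_derive x 1 g (f1 x - f2 x)) ->
  (forall x, D x -> {for x, continuous f1}) ->
  (forall x, D x -> {for x, continuous f2}) ->
  (forall x, D x -> 0 <= f1 x) -> (forall x, D x -> 0 <= f2 x) ->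
  g (b n) - g (a n) @[n --> \oo] --> l ->
  (\int[mu]_(x in D) (f1 x)%:E = \int[mu]_(x in D) (f2 x)%:E + l%:E)%E.
Proof.
move=> ab aS bS D dg cf1 cf2 f10 f20 gl.
have abD n : [set` `[a n, b n]] `<=` D by move=> x xab; exists n.
have wc (f : R -> R) n : (forall x, D x -> {for x, continuous f}) ->
    {within `[a n, b n], continuous f}.
  move=> cf; apply: continuous_in_subspaceT => x /[!inE] xab.
  exact/cf/(abD n).
have intf (f : R -> R) n : (forall x, D x -> {for x, continuous f}) ->
    mu.-integrable `[a n, b n] (EFin \o f).
  move=> cf; apply: continuous_compact_integrable; first exact: segment_compact.
  exact: wc.
have nd : nondecreasing_seq (fun n => [set` `[a n, b n]]).
  apply/nondecreasing_seqP => n; rewrite subsetEset => x /=.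
  rewrite !in_itv/= => /andP[ax xb].
  by rewrite (le_trans (aS n))//= (le_trans xb).
have lim (f : R -> R) : (forall x, D x -> {for x, continuous f}) ->
    (forall x, D x -> 0 <= f x) ->
    (\int[mu]_(x in `[a n, b n]) (f x)%:E @[n --> \oo] -->
     \int[mu]_(x in D) (f x)%:E)%E.
  move=> cf f0; apply: ge0_nondecreasing_set_cvg_integral => //.
    by move=> n; apply: measurable_int (intf f n cf).
  by move=> n x xab; rewrite lee_fin; apply/f0/(abD n).
(* On a segment both integrals are finite and may be subtracted; written as a sum, the identity
   survives the passage to infinite limits. *)
have step n : (\int[mu]_(x in `[a n, b n]) (f1 x)%:E =
    \int[mu]_(x in `[a n, b n]) (f2 x)%:E + (g (b n) - g (a n))%:E)%E.
  have cg x : D x -> {for x, continuous g}.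
    by move=> /dg /is_derive_continuous.
  have ftc : (\int[mu]_(x in `[a n, b n]) (f1 x - f2 x)%:E =
      (g (b n))%:E - (g (a n))%:E)%E.
    apply: (@continuous_FTC2 _ (fun x => f1 x - f2 x)) => //.
    - apply: wc => x Dx; apply: cvgB; [exact: cf1|exact: cf2].
    - have [_ ca cb] := (continuous_within_itvP g (ab n)).1 (wc g n cg).
      split => // x xab; have [] := dg x _ => //.
      by apply: (abD n); exact: subset_itv_oo_cc xab.
    - move=> x xab; rewrite derive1E; apply: derive_val.
      by apply/dg/(abD n); exact: subset_itv_oo_cc xab.
  move: ftc; under eq_integral do rewrite EFinB.
  rewrite integralB_EFin//; [|exact: intf|exact: intf].
  rewrite -EFinB => <-; rewrite addeC subeK//.
  exact: integrable_fin_num (intf f2 n cf2).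
apply: (cvg_unique (@ereal_hausdorff R) (lim f1 cf1 f10)).
rewrite /= (eq_cvg _ _ step).
apply: cvgeD; [by rewrite fin_num_adde_defl|exact: lim|].
by apply: cvg_EFin gl; exact: nearW.
Qed.

End improper_FTC.

(** * Gamma integrals *)

Section gamma_integrals.
Context {R : realType}.
Local Notation mu := (@lebesgue_measure R).
Implicit Types alpha r x : R.

Lemma is_derive1_expRMl (k x : R) :
  is_derive x 1 (fun y => expR (k * y)) (k * expR (k * x)).
Proof.
have dk : is_derive x 1 (k \*: (@id R)) (k *: (1 : R)) by exact: is_deriveZ.
have := is_derive1_comp (is_derive_expR (k * x)) dk.
by move=> h; apply: is_derive_eq h _; rewrite scaler1 mulrC.
Qed.

(** The right end is [n.+2] so that the segment is nondegenerate already at [n = 0], as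
    [ge0_improper_FTC] requires. *)
Lemma itv0y_bigcup :
  `]0%R, +oo[%classic = \bigcup_n `[(n.+1%:R^-1 : R), n.+2%:R]%classic.
Proof.
apply/seteqP; split => [x /=|x [n _ /=]]; rewrite !in_itv/= ?andbT.
  move=> x0.
  pose n := (Num.truncn (Num.max x x^-1)).+1.
  have xn : Num.max x x^-1 < n%:R by exact: truncnS_gt.
  exists n => //=; rewrite in_itv/=.
  move: xn; rewrite gt_max => /andP[xn xVn]; apply/andP; split.
    rewrite -[leRHS]invrK lef_pV2 ?posrE ?invr_gt0// (le_trans (ltW xVn))//.
    by rewrite ler_nat.
  by rewrite (le_trans (ltW xn))// ler_nat leqW.
by move=> /andP[+ _]; apply: lt_le_trans; rewrite invr_gt0.
Qed.

Lemma cvg_powR0 alpha (u : nat -> R) : 0 < alpha -> (forall n, 0 < u n) ->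
  u n @[n --> \oo] --> 0 -> u n `^ alpha @[n --> \oo] --> 0.
Proof.
move=> a0 u0 cu.
by have /cvg_at_rightP := powR_cvg0 a0; apply.
Qed.

(** The quadratic term of the exponential series beats the linear factor and leaves a bound of order
    [1 / n]. *)
Lemma cvg_mul_expRN (c : R) : 0 < c ->
  n.+2%:R * expR (- (c * n.+2%:R)) @[n --> \oo] --> 0.
Proof.
move=> c0; apply: (@squeeze_cvgr _ _ _ _ (cst 0) (fun n => 2 / c ^+ 2 * harmonic n)).
- apply: nearW => n /=; rewrite mulr_ge0 ?expR_ge0//= expRN.
  rewrite ler_pdivrMr ?expR_gt0//.
  have cn0 : 0 <= c * n.+2%:R by rewrite mulr_ge0// ltW.
  have := expR_ge1Dxn 1 cn0; rewrite (_ : 2`! = 2)%N// => h.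
  apply: (@le_trans _ _ (2 / c ^+ 2 / n.+2%:R * ((c * n.+2%:R) ^+ 2 / 2%:R))).
    rewrite le_eqVlt; apply/orP; left; apply/eqP; field.
    by rewrite (gt_eqF c0) andbT -natrD pnatr_eq0.
  apply: ler_pM => //.
  - by rewrite !mulr_ge0 ?invr_ge0// exprn_ge0// ltW.
  - by rewrite mulr_ge0// exprn_ge0.
  - rewrite ler_wpM2l// ?mulr_ge0 ?invr_ge0 ?exprn_ge0// ?ltW//.
    by rewrite ltf_pV2 ?posrE// ltr_nat.
  - by rewrite (le_trans _ h)// lerDr.
- exact: cvg_cst.
- rewrite -[X in _ --> X](mulr0 (2 / c ^+ 2)).
  by apply: cvgMr; exact: cvg_harmonic.
Qed.

(** Taking the power [alpha] out of the whole product, with rate [r / alpha] inside, reduces a real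
    exponent to the linear case. *)
Lemma cvg_powR_expRN alpha r : 0 < alpha -> 0 < r ->
  n.+2%:R `^ alpha * expR (- (r * n.+2%:R)) @[n --> \oo] --> 0.
Proof.
move=> a0 r0.
have -> : (fun n : nat => n.+2%:R `^ alpha * expR (- (r * n.+2%:R))) =
    (fun n => (n.+2%:R * expR (- (r / alpha * n.+2%:R))) `^ alpha).
  apply/funext => n; rewrite powRM ?expR_ge0//; congr (_ * _).
  by rewrite -expRM; congr expR; field; rewrite gt_eqF.
apply: cvg_powR0 => //; first by move=> n; rewrite mulr_gt0 ?expR_gt0.
by apply: cvg_mul_expRN; rewrite divr_gt0.
Qed.

(** The power [alpha] of [x] times [expR (- (r * x))] vanishes at both ends of the half-line, and
    its derivative is the difference of the two integrands. *)
Lemma gamma_integral_rec alpha r : 0 < alpha -> 0 < r ->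
  (alpha%:E * \int[mu]_(x in `]0%R, +oo[) (x `^ (alpha - 1) * expR (- (r * x)))%:E =
   r%:E * \int[mu]_(x in `]0%R, +oo[) (x `^ alpha * expR (- (r * x)))%:E)%E.
Proof.
move=> a0 r0.
have mE : measurable_fun setT (fun x => expR (- (r * x))).
  by apply: measurableT_comp => //; apply: measurableT_comp => //; exact: mulrl_measurable.
have mp (b : R) : measurable_fun (`]0%R, +oo[%classic : set R) (fun x : R => (x `^ b * expR (- (r * x)))%:E).
  apply/measurable_EFinP/measurable_funTS/measurable_funM => //.
have Z (k b : R) : 0 <= k ->
    (k%:E * \int[mu]_(x in `]0%R, +oo[) (x `^ b * expR (- (r * x)))%:E =
     \int[mu]_(x in `]0%R, +oo[) (k * (x `^ b * expR (- (r * x))))%:E)%E.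
  move=> k0; rewrite -ge0_integralZl ?lee_fin//; first exact: mp.
  by move=> x _; rewrite lee_fin mulr_ge0 ?powR_ge0 ?expR_ge0.
rewrite (Z _ _ (ltW a0)) (Z _ _ (ltW r0)).
have dE x : is_derive x 1 (fun y => expR (- (r * y))) (- (r * expR (- (r * x)))).
  have := is_derive1_expRMl (- r) x; rewrite !mulNr.
  by under eq_fun do rewrite mulNr.
have dp (b x : R) : 0 < x -> is_derive x (1:R) (fun y : R => y `^ b) (b * x `^ (b - 1)).
  by move=> x0; exact: is_derive1_powR.
have cp (b x : R) : 0 < x -> {for x, continuous (fun y : R => y `^ b * expR (- (r * y)) : R)}.
  move=> x0; apply: cvgM.
    exact: is_derive_continuous (dp b x x0).
  exact: is_derive_continuous (dE x).
rewrite itv0y_bigcup.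
rewrite -[RHS]adde0.
apply: (@ge0_improper_FTC _ (fun x => x `^ alpha * expR (- (r * x)))
  (fun x => alpha * (x `^ (alpha - 1) * expR (- (r * x))))
  (fun x => r * (x `^ alpha * expR (- (r * x)))) _ _ 0).
- move=> n; apply: (@le_lt_trans _ _ 1); last by rewrite ltr1n.
  by rewrite invf_le1// ler1n.
- by move=> n; rewrite lef_pV2 ?posrE// ler_nat.
- by move=> n; rewrite ler_nat.
- rewrite -itv0y_bigcup => x; rewrite /= in_itv/= andbT => x0.
  have := is_deriveM (dp alpha x x0) (dE x).
  by move=> h; apply: is_derive_eq h _; rewrite /GRing.scale/=; ring.
- rewrite -itv0y_bigcup => x; rewrite /= in_itv/= andbT => x0.
  by apply: cvgM; [exact: cvg_cst|exact: cp].
- rewrite -itv0y_bigcup => x; rewrite /= in_itv/= andbT => x0.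
  by apply: cvgM; [exact: cvg_cst|exact: cp].
- by move=> x _; rewrite !mulr_ge0 ?powR_ge0 ?expR_ge0// ltW.
- by move=> x _; rewrite !mulr_ge0 ?powR_ge0 ?expR_ge0// ltW.
- rewrite -[X in _ --> X](subrr 0); apply: cvgB; first exact: cvg_powR_expRN.
  rewrite -[X in _ --> X](mul0r (expR (- (r * 0)))); apply: cvgM.
    by apply: cvg_powR0 => //; exact: cvg_harmonic.
  exact: cvg_comp cvg_harmonic (is_derive_continuous (dE 0)).
Qed.

(** Read from right to left, a negative power of [r] becomes a Laplace integral, the form in which
    it is used for normalized gamma variables. *)
Lemma gamma_integral_nat (s : nat) r : 0 < r ->
  (\int[mu]_(x in `]0%R, +oo[) (x ^+ s * expR (- (r * x)))%:E =
   (s`!%:R / r ^+ s.+1)%:E)%E.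
Proof.
move=> r0; elim: s => [|s ih].
  have dE x : is_derive x 1 (fun y : R => - (r^-1 * expR (- r * y))) (expR (- r * x)).
    have d1 := is_derive1_expRMl (- r) x.
    have := is_deriveN (is_deriveZ r^-1 d1).
    move=> h; apply: is_derive_eq h _; rewrite /GRing.scale/=.
    by rewrite mulNr mulrN opprK mulrA mulVf ?mul1r// gt_eqF.
  have cE x : {for x, continuous (fun y : R => expR (- r * y))}.
    exact: is_derive_continuous (is_derive1_expRMl (- r) x).
  under eq_integral do rewrite expr0 mul1r -mulNr.
  rewrite itv0y_bigcup -[RHS]add0e.
  rewrite -[X in (X + _)%E](integral0 mu (\bigcup_n `[(n.+1%:R^-1 : R), n.+2%:R]%classic)).
  apply: (@ge0_improper_FTC _ (fun x => - (r^-1 * expR (- r * x)))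
    (fun x => expR (- r * x)) (cst 0)).
  - move=> n; apply: (@le_lt_trans _ _ 1); last by rewrite ltr1n.
    by rewrite invf_le1// ler1n.
  - by move=> n; rewrite lef_pV2 ?posrE// ler_nat.
  - by move=> n; rewrite ler_nat.
  - by move=> x _; rewrite subr0.
  - by move=> x _; exact: cE.
  - by move=> x _; exact: cvg_cst.
  - by move=> x _; exact: expR_ge0.
  - by move=> x _.
  - have -> : 0`!%:R / r ^+ 1 = - (r^-1 * 0) - - (r^-1 * expR (- r * 0)).
      by rewrite !mulr0 oppr0 add0r opprK expR0 mulr1 expr1 fact0 div1r.
    have c0 := cE 0.
    apply: cvgB; apply: cvgN; apply: cvgMr; last exact: cvg_comp cvg_harmonic c0.
    apply: (@squeeze_cvgr _ _ _ _ (cst 0)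
      (fun n => n.+2%:R * expR (- (r * n.+2%:R)))).
    + apply: nearW => n /=; rewrite expR_ge0/= mulNr ler_peMl ?expR_ge0//.
      by rewrite ler1n.
    + exact: cvg_cst.
    + exact: cvg_mul_expRN.
have := @gamma_integral_rec s.+1%:R r _ r0.
have powRn (b : nat) : (\int[mu]_(x in `]0%R, +oo[) (x `^ b%:R * expR (- (r * x)))%:E =
  \int[mu]_(x in `]0%R, +oo[) (x ^+ b * expR (- (r * x)))%:E)%E.
  apply: eq_integral => x; rewrite inE/= in_itv/= andbT => x0.
  by rewrite powR_mulrn// ltW.
have -> : (s.+1%:R - 1 = s%:R :> R) by rewrite -natr1 addrK.
rewrite !powRn ih ltr0n => /(_ isT).
set I := (\int[mu]_(x in _) _)%E => h.
rewrite -[LHS]mul1e -[in LHS](mulVf (lt0r_neq0 r0)) EFinM -muleA -h -!EFinM.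
congr EFin; rewrite factS natrM (exprS r s.+1); field.
by rewrite expf_neq0 gt_eqF.
Qed.

End gamma_integrals.

(** * Beta integrals *)

Section beta_integral.
Context {R : realType}.
Local Notation mu := (@lebesgue_measure R).

(** The shift by [3] is the first for which the segment at [n = 0] is nondegenerate. *)
Lemma itv01_bigcup :
  `]0%R, 1%R[%classic =
  \bigcup_n `[(n.+3%:R^-1 : R), 1 - n.+3%:R^-1]%classic.
Proof.
apply/seteqP; split => [x /=|x [n _ /=]]; rewrite !in_itv/=.
  move=> /andP[x0 x1].
  have y0 : 0 < 1 - x by rewrite subr_gt0.
  pose n := (Num.truncn (Num.max (1 - x)^-1 x^-1)).+1.
  have : Num.max (1 - x)^-1 x^-1 < n%:R by exact: truncnS_gt.
  rewrite gt_max => /andP[yVn xVn].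
  have le (y : R) : 0 < y -> y^-1 < n%:R -> n.+3%:R^-1 <= y.
    move=> y_gt0 yn; rewrite -[leRHS]invrK lef_pV2 ?posrE ?invr_gt0//.
    by rewrite (le_trans (ltW yn))// ler_nat (leq_trans (leqnSn _))// leqW.
  exists n => //=; rewrite in_itv/= le//= lerBrDl -lerBrDr.
  exact: le.
move=> /andP[nx xn]; have n0 : 0 < n.+3%:R^-1 :> R by rewrite invr_gt0.
by rewrite (lt_le_trans n0 nx)/= (le_lt_trans xn)// gtrBl.
Qed.

Lemma beta_integral_rec (a b : R) : 0 < a -> 0 < b ->
  (a%:E * \int[mu]_(x in `]0%R, 1%R[) (x `^ (a - 1) * (1 - x) `^ b)%:E =
   b%:E * \int[mu]_(x in `]0%R, 1%R[) (x `^ a * (1 - x) `^ (b - 1))%:E)%E.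
Proof.
move=> a0 b0.
have mp (p q : R) : measurable_fun (`]0%R, 1%R[%classic : set R)
    (fun x : R => (x `^ p * (1 - x) `^ q)%:E).
  apply/measurable_EFinP/measurable_funTS/measurable_funM => //.
  apply: (measurableT_comp (measurable_powR q)).
  exact: measurable_funB.
have Z (k p q : R) : 0 <= k ->
    (k%:E * \int[mu]_(x in `]0%R, 1%R[) (x `^ p * (1 - x) `^ q)%:E =
     \int[mu]_(x in `]0%R, 1%R[) (k * (x `^ p * (1 - x) `^ q))%:E)%E.
  move=> k0; rewrite -ge0_integralZl ?lee_fin//; first exact: mp.
  by move=> x _; rewrite lee_fin mulr_ge0 ?powR_ge0.
rewrite (Z _ _ _ (ltW a0)) (Z _ _ _ (ltW b0)).
have dp (p x : R) : 0 < x -> is_derive x (1:R) (fun y : R => y `^ p) (p * x `^ (p - 1)).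
  by move=> x0; exact: is_derive1_powR.
have dq (p x : R) : x < 1 -> is_derive x (1:R) (fun y : R => (1 - y) `^ p)
    (- (p * (1 - x) `^ (p - 1))).
  move=> x1; have y0 : 0 < 1 - x by rewrite subr_gt0.
  have d1 : is_derive x (1:R) (fun y : R => 1 - y) (- 1).
    by rewrite -sub0r; exact: is_deriveB.
  have := @is_derive1_comp _ (fun y : R => y `^ p) (fun y : R => 1 - y) x _ _
    (dp p _ y0) d1.
  by move=> h; apply: is_derive_eq h _; rewrite mulrN1.
have cp (p q x : R) : 0 < x -> x < 1 ->
    {for x, continuous (fun y : R => y `^ p * (1 - y) `^ q : R)}.
  move=> x0 x1; apply: cvgM.
    exact: is_derive_continuous (dp p x x0).
  exact: is_derive_continuous (dq q x x1).
rewrite itv01_bigcup -[RHS]adde0.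
have harm3 : (n.+3%:R^-1 : R) @[n --> \oo] --> 0.
  by have := @cvg_harmonic R; rewrite -(cvg_shiftn 2); under eq_cvg do rewrite /= addn2.
apply: (@ge0_improper_FTC _ (fun x => x `^ a * (1 - x) `^ b)
  (fun x => a * (x `^ (a - 1) * (1 - x) `^ b))
  (fun x => b * (x `^ a * (1 - x) `^ (b - 1))) _ _ 0).
- move=> n; rewrite ltrBrDr [ltRHS]splitr div1r.
  by rewrite ltrD// ltf_pV2 ?posrE// ltr_nat.
- by move=> n; rewrite lef_pV2 ?posrE// ler_nat.
- by move=> n; rewrite lerB// lef_pV2 ?posrE// ler_nat.
- rewrite -itv01_bigcup => x; rewrite /= in_itv/= => /andP[x0 x1].
  have := is_deriveM (dp a x x0) (dq b x x1).
  by move=> h; apply: is_derive_eq h _; rewrite /GRing.scale/=; ring.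
- rewrite -itv01_bigcup => x; rewrite /= in_itv/= => /andP[x0 x1].
  by apply: cvgM; [exact: cvg_cst|exact: cp].
- rewrite -itv01_bigcup => x; rewrite /= in_itv/= => /andP[x0 x1].
  by apply: cvgM; [exact: cvg_cst|exact: cp].
- by move=> x _; rewrite !mulr_ge0 ?powR_ge0// ltW.
- by move=> x _; rewrite !mulr_ge0 ?powR_ge0// ltW.
(* One estimate for both ends: at [1] the roles of [a] and [b] are exchanged. *)
- have lim (u v : nat -> R) (p q : R) : 0 < p -> 0 < q -> (forall n, 0 < u n) ->
     (forall n, 0 <= v n <= 1) -> u n @[n --> \oo] --> 0 ->
     u n `^ p * v n `^ q @[n --> \oo] --> 0.
    move=> p0 q0 u0 v1 cu.
    apply: (@squeeze_cvgr _ _ _ _ (cst 0) (fun n => u n `^ p)).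
    + apply: nearW => n /=; rewrite mulr_ge0 ?powR_ge0//=.
      rewrite ler_piMr ?powR_ge0//.
      have /andP[vn0 vn1] := v1 n.
      have <- : 1 `^ q = 1 :> R by rewrite powR1.
      by rewrite ge0_ler_powR ?nnegrE// ltW.
    + exact: cvg_cst.
    + exact: cvg_powR0.
  have bd n : 0 <= (n.+3%:R^-1 : R) <= 1.
    by rewrite invr_ge0 ler0n invf_le1 ?ltr0n// ler1n.
  rewrite -[X in _ --> X](subrr 0); apply: cvgB.
    have -> : (fun n => (1 - n.+3%:R^-1) `^ a * (1 - (1 - n.+3%:R^-1)) `^ b) =
        (fun n => n.+3%:R^-1 `^ b * (1 - n.+3%:R^-1) `^ a :> R).
      by apply/funext => n; rewrite mulrC opprB addrC subrK.
    by apply: lim => // n; have /andP[n0 n1] := bd n; rewrite subr_ge0 n1 gerBl.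
  by apply: lim => // n; have /andP[n0 n1] := bd n; rewrite subr_ge0 n1 gerBl.
Qed.

End beta_integral.

(** * Integration against laws given by unnormalized densities *)

Section density_laws.
Context d (O : measurableType d) (R : realType) (Pr : probability O R).
Local Notation mu := (@lebesgue_measure R).

Lemma integral_probability_comp (X : {RV Pr >-> R}) (g : R -> R)
    d' (O' : measurableType d') (nu : {measure set O' -> \bar R})
    (phi : O' -> R) (Y : O' -> \bar R) :
  measurable_fun setT phi -> measurable_fun setT Y -> (forall x, 0 <= Y x)%E ->
  (forall A : set R, measurable A ->
     Pr (X @^-1` A) = \int[nu]_x ((\1_A (phi x))%:E * Y x))%E ->
  measurable_fun setT g -> (forall x, 0 <= g x) ->
  (\int[Pr]_w (g (X w))%:E = \int[nu]_x ((g (phi x))%:E * Y x))%E.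
Proof.
move=> mphi mY Y0 XY mg g0.
transitivity (\int[Pr]_w ((g (X w))%:E * 1))%E.
  by apply: eq_integral => w _; rewrite mule1.
apply: (ge0_integral_agree (phi1 := X) (phi2 := phi) (Y1 := cst 1%E)
  (X := fun x => (g x)%:E)) => //.
- exact/measurable_EFinP.
- move=> A mA.
  rewrite -XY//.
  transitivity (\int[Pr]_w (\1_(X @^-1` A) w)%:E)%E.
    by apply: eq_integral => w _; rewrite mule1.
  by rewrite integral_indic ?setIT// -[X @^-1` A]setTI; exact: measurable_funPT.
Qed.

Lemma integral_dirac_law (X : {RV Pr >-> R}) (a : R) (g : R -> R) :
  has_law X (dirac a) -> measurable_fun setT g -> (forall x, 0 <= g x) ->
  (\int[Pr]_w (g (X w))%:E = (g a)%:E)%E.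
Proof.
move=> Xa mg g0.
have E (y : R) : (\int[Pr]_w (y%:E * cst 1 w) = y%:E)%E.
  under eq_integral do rewrite mule1.
  by rewrite integral_cst//= probability_setT mule1.
rewrite (@integral_probability_comp X g _ _ Pr (cst a) (cst 1%E))//.
  exact: (E (g a)).
by move=> A mA; rewrite (E (\1_A a)); exact: Xa.
Qed.

(** The constant stays abstract: it is the same for every [g] and cancels in the homogeneous
    recurrences between moments. *)
Lemma integral_density_law (X : {RV Pr >-> R}) (f : R -> R) :
  (forall x, 0 <= f x) -> measurable_fun setT f ->
  has_law X (normalized_density_law f) ->
  exists2 c : R, 0 < c & forall g : R -> R,
    measurable_fun setT g -> (forall x, 0 <= g x) ->
    (\int[Pr]_w (g (X w))%:E = c%:E * \int[mu]_x (g x * f x)%:E)%E.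
Proof.
move=> f0 mf Xf.
have If0 A : (0 <= \int[mu]_(x in A) (f x)%:E)%E.
  by apply: integral_ge0 => x _; rewrite lee_fin.
(* A law has total mass [1], whereas an integral equal to [0] or [+oo] has [fine] value [0] and, as
   [0^-1 = 0], would give mass [0]. The existence of [X] thus proves that [f] is integrable with
   positive integral. *)
have I1 : (fine (\int[mu]_x (f x)%:E) != 0).
  apply/eqP => I0; have := Xf setT measurableT.
  rewrite /normalized_density_law /= I0 invr0 mulr0 /distribution /=.
  rewrite /pushforward preimage_setT probability_setT => /eqP.
  by rewrite eqe oner_eq0.
have Ifin : (\int[mu]_x (f x)%:E)%E \is a fin_num.
  by move: I1 (If0 setT); case: (\int[mu]_x _)%E => //=; rewrite eqxx.
have Igt0 : 0 < fine (\int[mu]_x (f x)%:E) by rewrite lt_neqAle eq_sym I1 fine_ge0.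
exists (fine (\int[mu]_x (f x)%:E))^-1; first by rewrite invr_gt0.
set c := (fine _)^-1; move=> g mg g0.
have mgf : measurable_fun setT (fun x : R => (g x * f x)%:E).
  exact/measurable_EFinP/measurable_funM.
have mcf : measurable_fun setT (fun x : R => (c * f x)%:E).
  exact/measurable_EFinP/measurable_funM.
have mf' : measurable_fun setT (fun x : R => (f x)%:E) by exact/measurable_EFinP.
have c0 : 0 <= c by rewrite invr_ge0 ltW.
rewrite (@integral_probability_comp X g _ _ mu idfun (fun x => (c * f x)%:E))//.
- rewrite -ge0_integralZl//.
  + by apply: eq_integral => x _; rewrite -!EFinM mulrCA.
  + by move=> x _; rewrite lee_fin mulr_ge0.
- exact: measurable_id.
- by move=> x; rewrite lee_fin mulr_ge0.
move=> A mA; have := Xf A mA; rewrite /distribution /= /pushforward => ->.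
rewrite /normalized_density_law.
have IA : (\int[mu]_(x in A) (f x)%:E)%E \is a fin_num.
  rewrite ge0_fin_numE//; apply: (@le_lt_trans _ _ (\int[mu]_x (f x)%:E)%E).
    by apply: ge0_subset_integral => // x _; rewrite lee_fin.
  by rewrite -ge0_fin_numE.
have mfA : measurable_fun A (fun x : R => (f x)%:E) by exact: measurable_funTS.
rewrite mulrC -/c EFinM fineK// -ge0_integralZl ?lee_fin//; last first.
  by move=> x _; rewrite lee_fin.
rewrite integral_mkcond; apply: eq_integral => x _.
rewrite patchE indicE; case: (x \in A); first by rewrite mul1e EFinM.
by rewrite mul0e.
Qed.

End density_laws.

(** * Moment recurrences of gamma and beta variables *)

Section gamma_beta_moments.
Context d (O : measurableType d) (R : realType) (Pr : probability O R).
Local Notation mu := (@lebesgue_measure R).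

Lemma powR_addn (x a : R) (k : nat) : 0 < x ->
  x `^ (a + k%:R - 1) = x `^ (a - 1) * x ^+ k.
Proof.
move=> x0; rewrite -powR_mulrn ?ltW// -powRD ?(lt0r_neq0 x0) ?implybT//.
by rewrite addrAC.
Qed.

(** Absolute values keep the integrand nonnegative everywhere. Tilting by [expR (- (u * Z))] changes
    the rate of the gamma density from [1] to [1 + u], and the claim becomes [gamma_integral_rec].
    For [a = 0] the law is a point mass at [0] and both sides vanish. *)
Lemma gamma_law_moment (Z : {RV Pr >-> R}) (a u : R) (k : nat) :
  0 <= a -> 0 <= u -> has_law Z (gamma_law a) ->
  ((1 + u)%:E * \int[Pr]_w (`|Z w| ^+ k.+1 * expR (- (u * Z w)))%:E =
   (a + k%:R)%:E * \int[Pr]_w (`|Z w| ^+ k * expR (- (u * Z w)))%:E)%E.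
Proof.
move=> a0 u0 Za.
pose h k (x : R) := `|x| ^+ k * expR (- (u * x)).
have mh j : measurable_fun setT (h j).
  apply: measurable_funM; first by apply: measurable_funX; exact: normr_measurable.
  by do 2 apply: measurableT_comp => //.
have h0 j x : 0 <= h j x by rewrite mulr_ge0 ?exprn_ge0 ?expR_ge0.
move: a0; rewrite le_eqVlt => /predU1P[a0|a0].
  move: Za; rewrite -a0 /gamma_law eqxx add0r => Za.
  rewrite (integral_dirac_law Za (mh k.+1) (h0 _)) (integral_dirac_law Za (mh k) (h0 _)).
  rewrite /h normr0 !expr0n/= mul0r mule0; case: k => [|k]; first by rewrite mul0e.
  by rewrite mul0r mule0.
pose f (x : R) := if 0 < x then x `^ (a - 1) * expR (- x) else 0.
have mf : measurable_fun setT f.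
  apply: measurable_fun_ifT => //; first exact: measurable_fun_ltr.
  apply: measurable_funM; first exact: measurable_powR.
  by apply: measurableT_comp.
have f0 x : 0 <= f x.
  by rewrite /f; case: ifP => // _; rewrite mulr_ge0 ?powR_ge0 ?expR_ge0.
have {}Za : has_law Z (normalized_density_law f).
  by move=> A mA; rewrite Za// /gamma_law gt_eqF.
have [c c0 Zc] := integral_density_law f0 mf Za.
rewrite (Zc _ (mh k.+1) (h0 _)) (Zc _ (mh k) (h0 _)).
have E j : (\int[mu]_x (h j x * f x)%:E =
    \int[mu]_(x in `]0%R, +oo[) (x `^ (a + j%:R - 1) * expR (- ((1 + u) * x)))%:E)%E.
  rewrite [RHS]integral_mkcond; apply: eq_integral => x _.
  rewrite patchE mem_setE in_itv/= andbT /f; case: ifPn => x0; last by rewrite mulr0.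
  congr EFin; rewrite /h gtr0_norm//.
  by rewrite powR_addn// mulrDl mul1r opprD expRD; ring.
rewrite !E muleCA [RHS]muleCA; congr (_ * _)%E.
have -> : a + k.+1%:R - 1 = a + k%:R by rewrite -natr1 addrA addrK.
rewrite -gamma_integral_rec//; first by rewrite ltr_wpDr.
by rewrite ltr_wpDr.
Qed.

Lemma gamma_law_ge0 (Z : {RV Pr >-> R}) (a : R) : 0 <= a ->
  has_law Z (gamma_law a) ->
  {ae Pr, forall w, 0 <= Z w /\ (0 < a -> 0 < Z w)}.
Proof.
move=> a0 Za.
pose A : set R := if a == 0 then [set x | x < 0] else [set x | x <= 0].
have mA : measurable A.
  rewrite /A; case: ifP => _; first by rewrite -set_itvNyo.
  by rewrite -set_itvNyc.
exists (Z @^-1` A); split.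
- by rewrite -[X in measurable X]setTI; exact: measurable_funPT.
- have := Za A mA; rewrite /distribution/= /pushforward => ->.
  rewrite /gamma_law /A; case: eqVneq => [_|a_neq0].
    by rewrite diracE memNset//= ltxx.
  rewrite /normalized_density_law integral0_eq ?mul0r//.
  by move=> x /= x0; rewrite ifN// -leNgt.
- move=> w /= /not_andP Zw; rewrite /A; case: eqP Zw => [->|/eqP a_neq0].
    rewrite ltxx => -[|]; last by move=> /not_implyP[].
    by move=> /negP; rewrite -ltNge.
  case=> [/negP|/not_implyP[_ /negP]]; last by rewrite -leNgt.
  by rewrite -ltNge => /ltW.
Qed.

(** Cleared of denominators, so that it applies to moments not known to be finite or nonzero. *)
Lemma ratio_eq_shares (x x1 x2 : \bar R) (a b : R) : 0 <= a -> 0 <= b ->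
  (0 <= x1)%E -> (0 <= x2)%E -> (b%:E * x1 = a%:E * x2)%E -> (x1 + x2 = x)%E ->
  ((a + b)%:E * x1 = a%:E * x)%E /\ ((a + b)%:E * x2 = b%:E * x)%E.
Proof.
move=> a0 b0 x10 x20 rec <-.
rewrite EFinD !ge0_muleDl ?lee_fin// rec !ge0_muleDr//.
by rewrite rec.
Qed.

(** Two relations fix both shares: the moments at [(p.+1, q)] and [(p, q.+1)] add up to the one at
    [(p, q)] because [x + (1 - x) = 1] on the support, and [beta_integral_rec] gives their ratio. *)
Lemma beta_law_moment (U : {RV Pr >-> R}) (a b : R) (p q : nat) :
  0 <= a -> 0 < b -> has_law U (beta_law a b) ->
  let M p q := (\int[Pr]_w (`|U w| ^+ p * `|1 - U w| ^+ q)%:E)%E in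
  ((a + b + (p + q)%:R)%:E * M p.+1 q = (a + p%:R)%:E * M p q)%E /\
  ((a + b + (p + q)%:R)%:E * M p q.+1 = (b + q%:R)%:E * M p q)%E.
Proof.
move=> a0 b0 Uab M.
pose h p q (x : R) := `|x| ^+ p * `|1 - x| ^+ q.
have mh i j : measurable_fun setT (h i j).
  apply: measurable_funM; first by apply: measurable_funX; exact: normr_measurable.
  apply: measurable_funX; apply: measurableT_comp; first exact: normr_measurable.
  exact: measurable_funB.
have h0 i j x : 0 <= h i j x by rewrite mulr_ge0 ?exprn_ge0.
have M0 i j : (0 <= M i j)%E by apply: integral_ge0 => w _; rewrite lee_fin.
suff [rec sum] : ((b + q%:R)%:E * M p.+1 q = (a + p%:R)%:E * M p q.+1)%E /\
    (M p.+1 q + M p q.+1 = M p q)%E.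
  have ap0 : 0 <= a + p%:R by rewrite addr_ge0.
  have bq0 : 0 <= b + q%:R by rewrite addr_ge0// ltW.
  have -> : a + b + (p + q)%:R = (a + p%:R) + (b + q%:R) by rewrite natrD addrACA.
  exact: ratio_eq_shares.
move: a0; rewrite le_eqVlt => /predU1P[a0|a0].
  move: Uab; rewrite -a0 /beta_law eqxx add0r => Uab.
  have ME i j : M i j = (h i j 0)%:E by exact: (integral_dirac_law Uab).
  rewrite !ME /h subr0 normr0 normr1 !expr1n !mulr1 expr0n/= mule0 add0e.
  by case: p => [|p]; split; rewrite ?mul0e// expr0n/= mule0.
pose f (x : R) := if 0 < x < 1 then x `^ (a - 1) * (1 - x) `^ (b - 1) else 0.
have mf : measurable_fun setT f.
  apply: measurable_fun_ifT => //.
    by apply: measurable_and; exact: measurable_fun_ltr.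
  apply: measurable_funM; first exact: measurable_powR.
  apply: (measurableT_comp (measurable_powR _)); exact: measurable_funB.
have f0 x : 0 <= f x.
  by rewrite /f; case: ifP => // _; rewrite mulr_ge0 ?powR_ge0.
have {}Uab : has_law U (normalized_density_law f).
  by move=> A mA; rewrite Uab// /beta_law gt_eqF.
have [c c0 Uc] := integral_density_law f0 mf Uab.
have ME i j : M i j = (c%:E * \int[mu]_x (h i j x * f x)%:E)%E by exact: Uc.
have E i j : (\int[mu]_x (h i j x * f x)%:E =
    \int[mu]_(x in `]0%R, 1%R[)
      (x `^ (a + i%:R - 1) * (1 - x) `^ (b + j%:R - 1))%:E)%E.
  rewrite [RHS]integral_mkcond; apply: eq_integral => x _.
  rewrite patchE mem_setE in_itv/= /f; case: ifPn => x01; last by rewrite mulr0.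
  have [x0 x1] := andP x01; have y0 : 0 < 1 - x by rewrite subr_gt0.
  congr EFin; rewrite /h !gtr0_norm//.
  by rewrite !powR_addn//; ring.
have mE i j : measurable_fun setT (fun x : R => (h i j x * f x)%:E).
  by apply/measurable_EFinP; exact: measurable_funM.
have E0 i j (x : R) : [set: R] x -> (0 <= (h i j x * f x)%:E)%E.
  by move=> _; rewrite lee_fin mulr_ge0.
split; last first.
  rewrite (ME p q); have <- : (\int[mu]_x (h p.+1 q x * f x)%:E +
      \int[mu]_x (h p q.+1 x * f x)%:E = \int[mu]_x (h p q x * f x)%:E)%E.
    rewrite -ge0_integralD//; [|exact: E0|exact: mE|exact: E0|exact: mE].
    apply: eq_integral => x _.
    rewrite -EFinD -mulrDl; congr EFin; rewrite /f.
    case: ifPn => [/andP[x0 x1]|]; last by rewrite !mulr0.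
    congr (_ * _); rewrite /h !gtr0_norm ?subr_gt0// !exprS; ring.
  have I0 i j : (0 <= \int[mu]_x (h i j x * f x)%:E)%E.
    by apply: integral_ge0 => x; exact: E0.
  by rewrite (ge0_muleDr _ (I0 p.+1 q) (I0 p q.+1)) (ME p.+1 q) (ME p q.+1).
rewrite !ME !E muleCA [RHS]muleCA; congr (_ * _)%E.
have -> : a + p.+1%:R - 1 = a + p%:R by rewrite -natr1 addrA addrK.
have -> : b + q.+1%:R - 1 = b + q%:R by rewrite -natr1 addrA addrK.
by rewrite beta_integral_rec// ltr_wpDr.
Qed.

End gamma_beta_moments.

(** * Urn identity for normalized gamma variables *)

Lemma prodr_count_mem (R : comPzRingType) (I : finType) (s : seq I) (f : I -> R) :
  \prod_(k <- s) f k = \prod_k f k ^+ count_mem k s.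
Proof.
elim: s => [|j s ih].
  by rewrite big_nil big1// => k _; rewrite expr0.
rewrite big_cons ih (bigD1 j)//= [RHS](bigD1 j)//= eqxx exprS mulrA.
congr (_ * _); apply: eq_bigr => k kj.
by rewrite eq_sym (negbTE kj).
Qed.

Lemma measurable_invr (R : realType) : measurable_fun setT (fun x : R => x^-1).
Proof.
have -> : (fun x : R => x^-1) =
    (fun x => if 0 <= x then x `^ (- 1) else - ((- x) `^ (- 1))).
  apply/funext => x; case: ifPn => [x0|]; first by rewrite powR_inv1.
  by rewrite -ltNge => x0; rewrite powR_inv1 ?oppr_ge0 ?ltW// invrN opprK.
have mp : measurable_fun setT (fun x : R => x `^ (- 1)) by exact: measurable_powR.
apply: measurable_fun_ifT => //; first exact: measurable_fun_ler.
by apply: measurableT_comp => //; exact: (measurableT_comp mp).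
Qed.

Section dirichlet_urn.
Context d (O : measurableType d) (R : realType) (Q : probability O R).
Variables (n : nat) (a : 'I_n -> R) (Z : 'I_n -> {RV Q >-> R}).
Hypothesis a0 : forall k, 0 <= a k.
Hypothesis suma_gt0 : 0 < \sum_k a k.
Hypothesis indep : mutually_independent Q (fun k => events (Z k)).
Hypothesis law : forall k, has_law (Z k) (gamma_law (a k)).
Local Notation mu := (@lebesgue_measure R).

Let G w := \sum_k Z k w.
Let X k w := Z k w / G w.
Let W (s : seq 'I_n) w := \prod_(k <- s) `|Z k w|.

(* The moments of the normalized variables [X] are reached through
   [n! / G ^+ n.+1 = \int_0^oo u ^+ n * expR (- (u * G)) du], which turns them
   into integrals in [u] of the product [Phi s u] of gamma moments. *)
Let Phi (s : seq 'I_n) u := (\int[Q]_w (W s w * expR (- (u * G w)))%:E)%E.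

Let mZ k : measurable_fun setT (Z k : O -> R).
Proof. exact: measurable_funPT. Qed.

Let mG : measurable_fun setT G.
Proof. by apply: measurable_sum => k; exact: mZ. Qed.

Let mW s : measurable_fun setT (W s).
Proof.
apply: measurable_prod => k _; apply: measurableT_comp; last exact: mZ.
exact: normr_measurable.
Qed.

Let W0 s w : 0 <= W s w.
Proof. exact: prodr_ge0. Qed.

Let PhiE s u : (Phi s u =
  \prod_k \int[Q]_w (`|Z k w| ^+ count_mem k s * expR (- (u * Z k w)))%:E)%E.
Proof.
rewrite /Phi.
pose h (k : 'I_n) (x : R) := (`|x| ^+ count_mem k s * expR (- (u * x)))%:E.
transitivity (\int[Q]_w (\prod_(k <- index_enum 'I_n) h k (Z k w)))%E.
  apply: eq_integral => w _; rewrite /W prodr_count_mem /G mulr_sumr -sumrN.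
  by rewrite expR_sum -big_split/= prodEFin.
rewrite (@expectation_prod _ _ _ Q _ _ (fun=> R : measurableType _) (fun k => Z k : O -> R) h)//.
- move=> k; apply/measurable_EFinP/measurable_funM.
    by apply: measurable_funX; exact: normr_measurable.
  by do 2 apply: measurableT_comp => //.
- by move=> k x; rewrite lee_fin mulr_ge0 ?exprn_ge0 ?expR_ge0.
- exact: index_enum_uniq.
Qed.

Let Phi_cons j s u : 0 <= u ->
  ((1 + u)%:E * Phi (j :: s) u = (a j + (count_mem j s)%:R)%:E * Phi s u)%E.
Proof.
move=> u0; rewrite !PhiE (bigD1 j)//= [in RHS](bigD1 j)//= !muleA eqxx add1n.
rewrite (gamma_law_moment _ (a0 j) u0 (law j)); congr (_ * _)%E.
by apply: eq_bigr => k kj; rewrite eq_sym (negbTE kj).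
Qed.

Let ZG : {ae Q, forall w, (forall k, 0 <= Z k w) /\ 0 < G w}.
Proof.
have [k ak] : exists k, 0 < a k.
  have [//|/forallNP h] := pselect (exists k, 0 < a k).
  move: suma_gt0; rewrite big1 ?ltxx// => k _.
  by apply/eqP; rewrite eq_le a0 andbT leNgt; apply/negP/h.
have ae : {ae Q, forall w, forall k : 'I_n, 0 <= Z k w /\ (0 < a k -> 0 < Z k w)}.
  by apply: filter_forall => i; exact: (gamma_law_ge0 (a0 i) (law i)).
apply: filterS ae => w Zw; split=> [i|]; first by have [] := Zw i.
rewrite /G (bigD1 k)//= ltr_wpDr//.
  by apply: sumr_ge0 => i _; have [] := Zw i.
by have [_] := Zw k; exact.
Qed.

(** What is left of a moment with an additional index [j] once the factor depending on [j] is taken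
    out; the denominator [1 + u] comes from [Phi_cons]. *)
Let C s := (\int[mu]_(u in `]0%R, +oo[)
  ((u ^+ size s / (1 + u))%:E * Phi s u))%E.

Let mX k : measurable_fun setT (fun w => `|X k w|).
Proof.
apply: measurableT_comp; first exact: normr_measurable.
apply: measurable_funM; first exact: mZ.
exact: (measurableT_comp (@measurable_invr R)).
Qed.

(** Joint integrand for Tonelli's theorem, set to zero for [u <= 0] so that the Laplace integral
    runs over the whole line. *)
Let F s p (w_u : O * measurableTypeR R) : \bar R :=
  (if 0 < w_u.2 then W s w_u.1 * (w_u.2 ^+ p * expR (- (w_u.2 * G w_u.1))) else 0)%:E.

Let mF s p : measurable_fun setT (F s p).
Proof.
apply/measurable_EFinP/measurable_fun_ifT => //.
  by apply: measurable_fun_ltr => //; exact: measurable_snd.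
apply: measurable_funM; first exact: (measurableT_comp (mW s) measurable_fst).
apply: measurable_funM; first by apply: measurable_funX; exact: measurable_snd.
apply: measurableT_comp => //; apply: measurableT_comp => //.
apply: measurable_funM; first exact: measurable_snd.
exact: (measurableT_comp mG measurable_fst).
Qed.

Let F0 s p x : (0 <= F s p x)%E.
Proof.
rewrite /F; case: ifP => // x0.
by rewrite lee_fin !mulr_ge0// ?exprn_ge0 ?expR_ge0// ltW.
Qed.

Let mPhi s : measurable_fun setT (Phi s).
Proof.
pose f (p : O * measurableTypeR R) : \bar R :=
  (W s p.1 * expR (- (p.2 * G p.1)))%:E.
apply: (measurable_fun_fubini_tonelli_G f) => [|p].
  apply/measurable_EFinP/measurable_funM.
    exact: (measurableT_comp (mW s) measurable_fst).
  apply: measurableT_comp => //; apply: measurableT_comp => //.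
  apply: measurable_funM; first exact: measurable_snd.
  exact: (measurableT_comp mG measurable_fst).
by rewrite lee_fin mulr_ge0 ?expR_ge0.
Qed.

Let FE s p (u : R) : (\int[Q]_w F s p (w, u) =
  if (0 < u)%R then (u ^+ p)%:E * Phi s u else 0)%E.
Proof.
rewrite /F/=; case: ifPn => u0; last by rewrite integral0.
rewrite /Phi -ge0_integralZl//.
- by apply: eq_integral => w _; rewrite -EFinM mulrCA.
- apply/measurable_EFinP/measurable_funM => //.
  by do 3 apply: measurableT_comp => //.
- by move=> w _; rewrite lee_fin mulr_ge0 ?expR_ge0.
- by rewrite lee_fin exprn_ge0// ltW.
Qed.

(** The moment contains [1 / G] to the power [size s + 1], whence the factorial of [size s] in the
    Laplace formula. After exchanging the integrals, [Phi_cons] extracts the factor in [j]. *)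
Let step j s : ((size s)`!%:R%:E * \int[Q]_w (`|X j w| * \prod_(k <- s) `|X k w|)%:E =
  (a j + (count_mem j s)%:R)%:E * C s)%E.
Proof.
have mXs : measurable_fun setT (fun w => `|X j w| * \prod_(k <- s) `|X k w|).
  by apply: measurable_funM => //; apply: measurable_prod.
transitivity (\int[Q]_w \int[mu]_u F (j :: s) (size s) (w, u))%E.
  rewrite -ge0_integralZl//; last first.
  - by move=> w _; rewrite lee_fin mulr_ge0// prodr_ge0.
  - exact/measurable_EFinP.
  apply: ge0_ae_eq_integral => //.
  - apply: measurable_funeM; exact/measurable_EFinP.
  - exact: (measurable_fun_fubini_tonelli_F (F (j :: s) (size s)) (mF _ _)).
  - by move=> w _; rewrite mule_ge0// lee_fin mulr_ge0// prodr_ge0.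
  - by move=> w _; exact: integral_ge0.
  apply: filterS ZG => w [Zw Gw] _.
  have WE : (size s)`!%:R * (`|X j w| * \prod_(k <- s) `|X k w|) =
      W (j :: s) w * ((size s)`!%:R / G w ^+ (size s).+1).
    have E k : `|X k w| = `|Z k w| / G w.
      by rewrite /X normrM normfV (gtr0_norm Gw).
    rewrite E; under eq_bigr do rewrite E.
    have -> : \prod_(k <- s) (`|Z k w| / G w) = (\prod_(k <- s) `|Z k w|) / G w ^+ size s.
      elim: (s) => [|k s' ih]; first by rewrite !big_nil expr0 invr1 mulr1.
      by rewrite !big_cons ih /= exprS invfM; ring.
    by rewrite /W big_cons exprS invfM; ring.
  rewrite -EFinM WE EFinM -(gamma_integral_nat (size s) Gw) integral_mkcond.
  rewrite -ge0_integralZl ?lee_fin//.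
  - apply: eq_integral => u _; rewrite /F/= patchE mem_setE in_itv/= andbT.
    by case: ifPn => u0; [rewrite -EFinM (mulrC u)|rewrite mule0].
  - apply/(measurable_restrictT _ _).1 => //; apply/measurable_EFinP/measurable_funTS.
    apply: measurable_funM; first exact: measurable_funX.
    by do 2 apply: measurableT_comp => //; exact: mulrl_measurable.
  - move=> u _; rewrite patchE mem_setE in_itv/= andbT; case: ifPn => // u0.
    by rewrite lee_fin mulr_ge0 ?expR_ge0// exprn_ge0// ltW.
rewrite (fubini_tonelli (F (j :: s) (size s)))//.
transitivity (\int[mu]_(u in `]0%R, +oo[) ((u ^+ size s)%:E * Phi (j :: s) u))%E.
  rewrite [RHS]integral_mkcond; apply: eq_integral => u _.
  by rewrite FE patchE mem_setE in_itv/= andbT.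
rewrite /C -ge0_integralZl//.
- apply: eq_integral => u; rewrite inE/= in_itv/= andbT => u0.
  have u1 : 1 + u != 0 by rewrite gt_eqF// ltr_wpDr// ltW.
  rewrite [RHS]muleCA -Phi_cons ?ltW// muleA; congr (_ * _)%E.
  by rewrite -EFinM divfK.
- apply: measurable_funTS; apply: emeasurable_funM; last exact: mPhi.
  apply/measurable_EFinP/measurable_funM; first exact: measurable_funX.
  apply: (measurableT_comp (@measurable_invr R)); exact: measurable_funD.
- move=> u; rewrite /= in_itv/= andbT => u0; rewrite mule_ge0//.
    by rewrite lee_fin divr_ge0 ?exprn_ge0 ?addr_ge0// ltW.
  by apply: integral_ge0 => w _; rewrite lee_fin mulr_ge0 ?expR_ge0.
- by rewrite lee_fin addr_ge0.
Qed.

(** Summing [step] over [j], with [X] summing to [1] almost surely, expresses [C s] through the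
    moment of [s], so the integral [C s] is never computed. *)
Lemma dirichlet_urn j s :
  ((\sum_k a k + (size s)%:R)%:E *
     \int[Q]_w (`|X j w| * \prod_(k <- s) `|X k w|)%:E =
   (a j + (count_mem j s)%:R)%:E * \int[Q]_w (\prod_(k <- s) `|X k w|)%:E)%E.
Proof.
set S := \sum_k a k + (size s)%:R; set P := (\int[Q]_w (\prod_(k <- s) _)%:E)%E.
have fact0 : (size s)`!%:R != 0 :> R by rewrite pnatr_eq0 -lt0n fact_gt0.
have mP : measurable_fun setT (fun w => \prod_(k <- s) `|X k w|).
  exact: measurable_prod.
have SC : (S%:E * C s = (size s)`!%:R%:E * P)%E.
  transitivity (\sum_j (a j + (count_mem j s)%:R)%:E * C s)%E.
    rewrite -ge0_sume_distrl; last by move=> k _; rewrite lee_fin addr_ge0.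
    rewrite sumEFin big_split/= -natr_sum; congr ((_ + _%:R)%:E * _)%E.
    elim: s {S P fact0 mP} => [|k s ih] /=; first by rewrite big1.
    by rewrite big_split/= -ih (bigD1 k)//= eqxx big1// => i; rewrite eq_sym => /negbTE->.
  under eq_bigr do rewrite -step.
  rewrite -ge0_sume_distrr; last first.
    by move=> k _; apply: integral_ge0 => w _; rewrite lee_fin mulr_ge0// prodr_ge0.
  congr (_ * _)%E; rewrite -ge0_integral_sum//.
  - apply: ge0_ae_eq_integral => //.
    + apply: emeasurable_sum => k; apply/measurable_EFinP; exact: measurable_funM.
    + exact/measurable_EFinP.
    + by move=> w _; apply: sume_ge0 => k _; rewrite lee_fin mulr_ge0// prodr_ge0.
    + by move=> w _; rewrite lee_fin prodr_ge0.
    apply: filterS ZG => w [Zw Gw] _.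
    rewrite sumEFin -mulr_suml; congr EFin.
    rewrite (_ : \sum_i _ = 1) ?mul1r//.
    under eq_bigr do rewrite /X normrM normfV (ger0_norm (Zw _)) (gtr0_norm Gw).
    by rewrite -mulr_suml divff// gt_eqF.
  - by move=> k; apply/measurable_EFinP; exact: measurable_funM.
  - by move=> k w _; rewrite lee_fin mulr_ge0// prodr_ge0.
have inj x y : ((size s)`!%:R%:E * x = (size s)`!%:R%:E * y :> \bar R)%E -> x = y.
  move=> /(congr1 (fun z => (size s)`!%:R^-1%:E * z))%E.
  by rewrite !muleA -!EFinM mulVf// !mul1e.
apply: inj; rewrite muleCA step [LHS]muleCA SC.
by rewrite muleCA.
Qed.

End dirichlet_urn.

(** * Urn identity for the Dirichlet process *)

Section dirichlet_process_urn.
Context d (O : measurableType d) (R : realType) (Pr : probability O R).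
Context dE (E : measurableType dE).
Hypothesis E_discrete : forall A : set E, measurable A.
Variables (p : R.-pker O ~> E) (m : {measure set E -> \bar R}).
Hypothesis m_finite : (0 < m [set: E] < +oo)%E.
Hypothesis p_dir : dirichlet_process Pr p m.

(** The moments see only the atoms at the states in [j :: s]; these singletons and their complement
    form a finite partition, to which the finite-dimensional identity applies. *)
Lemma dirichlet_process_urn (j : E) (s : seq E) :
  ((fine (m [set: E]) + (size s)%:R)%:E *
     \int[Pr]_w (fine (p w [set j]) * \prod_(h <- s) fine (p w [set h]))%:E =
   (fine (m [set j]) + (count_mem j s)%:R)%:E *
     \int[Pr]_w (\prod_(h <- s) fine (p w [set h]))%:E)%E.
Proof.
pose u := undup (j :: s).
(* Cells of a [partition] must be nonempty, so the complement of [u] is a cell only when it contains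
   a point. As [index x u] is [size u] exactly outside [u], the same [A] covers both cases. *)
pose rest := ~~ `[< forall x : E, x \in u >].
pose n := (size u + rest)%N.
have idxn x : (index x u < n)%N.
  rewrite /n; case: (boolP rest) => [_|]; first by rewrite addn1 ltnS index_size.
  by rewrite negbK => /asboolP uT; rewrite addn0 index_mem.
pose A (k : 'I_n) : set E := [set x | index x u = k].
pose idx x : 'I_n := Ordinal (idxn x).
have Apart : partition [set: 'I_n] A [set: E].
  split.
  - by apply/seteqP; split => // x _; exists (idx x).
  - by move=> k l _ _ [x [/= xk xl]]; apply: val_inj; rewrite /= -xk.
  - move=> k _; have [ku|uk] := ltnP k (size u).
      by exists (nth j u k); rewrite /A /= index_uniq// undup_uniq.
    have : (k < size u + rest)%N := ltn_ord k.
    case: (boolP rest) => [r|_]; last first.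
      by rewrite addn0 ltnNge uk.
    rewrite addn1 ltnS => ku; have {uk ku} kE : k = size u :> nat.
      by apply/eqP; rewrite eqn_leq ku uk.
    move: r => /asboolPn /existsNP[x /negP xu]; exists x.
    by rewrite /A/= kE; apply/eqP; rewrite eqn_leq index_size leqNgt index_mem.
have A1 x : x \in u -> A (idx x) = [set x].
  move=> xu; apply/seteqP; split => [y /= yx|y -> //].
  have yu : y \in u by rewrite -index_mem yx index_mem.
  by rewrite -(nth_index j yu) yx nth_index.
have idx_inj : {in u &, injective idx}.
  move=> x y xu yu /(congr1 val)/= xy.
  by rewrite -(nth_index j xu) xy nth_index.
have ju : j \in u by rewrite mem_undup mem_head.
have su h : h \in s -> h \in u by move=> hs; rewrite mem_undup inE hs orbT.
pose a k := fine (m (A k)).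
have mfin B : m B \is a fin_num.
  rewrite ge0_fin_numE// (le_lt_trans _ (andP m_finite).2)//.
  by apply: le_measure => //; rewrite inE.
have sum_a : \sum_k a k = fine (m [set: E]).
  rewrite sum_fine//; congr fine.
  have [_ triv _] := Apart.
  rewrite -(measure_bigsetU_ord m xpredT)// -bigcup_seq; congr (m _).
  by apply/seteqP; split => // x _; exists (idx x) => //=; rewrite mem_index_enum.
have [d1 [V1 [Q [Z [ind law tupleE]]]]] := p_dir Apart.
pose phi1 w := [tuple fine (p w (A k)) | k < n].
pose phi2 w := [tuple Z k w / \sum_(l < n) Z l w | k < n].
have mphi1 : measurable_fun setT phi1.
  apply/measurable_fun_tnthP => i.
  rewrite (_ : _ \o _ = fun w => fine (p w (A i))); last first.
    by apply/funext => w /=; rewrite tnth_mktuple.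
  exact: (measurableT_comp (fine_measurable measurableT) (measurable_kernel p _ _)).
have mphi2 : measurable_fun setT phi2.
  apply/measurable_fun_tnthP => i.
  rewrite (_ : _ \o _ = fun w => Z i w / \sum_(l < n) Z l w); last first.
    by apply/funext => w /=; rewrite tnth_mktuple.
  apply: measurable_funM => //; apply: (measurableT_comp (@measurable_invr R)).
  exact: measurable_sum.
pose h t (v : n.-tuple R) := (\prod_(k <- t) `|tnth v (idx k)|)%:E.
have mh t : measurable_fun setT (fun v : n.-tuple R => h t v).
  apply/measurable_EFinP; apply: measurable_prod => k _.
  apply: measurableT_comp; first exact: normr_measurable.
  exact: measurable_tnth.
have int1 d'' (O'' : measurableType d'') (Q' : probability O'' R)
    (phi : O'' -> n.-tuple R) (B : set (n.-tuple R)) :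
    measurable_fun setT phi -> measurable B ->
    (\int[Q']_w ((\1_B (phi w))%:E * cst 1 w) = Q' [set w | B (phi w)])%E.
  move=> mphi mB; transitivity (\int[Q']_w (\1_(phi @^-1` B) w)%:E)%E.
    by apply: eq_integral => w _; rewrite mule1.
  by rewrite integral_indic ?setIT// -[X in measurable X]setTI; exact: mphi.
have transfer t : (\int[Pr]_w h t (phi1 w) = \int[Q]_w h t (phi2 w))%E.
  transitivity (\int[Pr]_w (h t (phi1 w) * cst 1 w))%E.
    by apply: eq_integral => w _; rewrite mule1.
  transitivity (\int[Q]_w (h t (phi2 w) * cst 1 w))%E; last first.
    by apply: eq_integral => w _; rewrite mule1.
  apply: (ge0_integral_agree (phi1 := phi1) (phi2 := phi2) (X := h t)) => //.
  - by move=> v; rewrite lee_fin; exact: prodr_ge0.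
  - by move=> B mB; rewrite !int1//; exact: tupleE.
have h1 t : {subset t <= u} ->
    (\int[Pr]_w h t (phi1 w) =
     \int[Pr]_w (\prod_(k <- t) fine (p w [set k]))%:E)%E.
  move=> tu; apply: eq_integral => w _; congr EFin.
  apply: eq_big_seq => k kt; rewrite tnth_mktuple A1; last exact: tu.
  by rewrite ger0_norm// fine_ge0.
have h2 t : (\int[Q]_w h t (phi2 w) = \int[Q]_w
    (\prod_(k <- [seq idx x | x <- t]) `|Z k w / \sum_l Z l w|)%:E)%E.
  apply: eq_integral => w _; congr EFin; rewrite big_map.
  by apply: eq_bigr => k _; rewrite tnth_mktuple.
have a0 k : 0 <= a k by rewrite fine_ge0.
have suma0 : 0 < \sum_k a k by rewrite sum_a fine_gt0.
have := dirichlet_urn a0 suma0 ind law (idx j) [seq idx x | x <- s].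
have -> : count_mem (idx j) [seq idx x | x <- s] = count_mem j s.
  rewrite count_map; apply: eq_in_count => x xs /=.
  by apply/eqP/eqP => [/idx_inj->//|->//]; exact: su.
have h2c : (\int[Q]_w h (j :: s) (phi2 w) = \int[Q]_w
    (`|Z (idx j) w / \sum_l Z l w| *
     \prod_(k <- [seq idx x | x <- s]) `|Z k w / \sum_l Z l w|)%:E)%E.
  by rewrite h2; apply: eq_integral => w _; rewrite /= big_cons.
rewrite -(h2 s) -h2c -!transfer !h1//.
- rewrite sum_a size_map /a A1//.
  by under eq_integral do rewrite big_cons.
- by move=> x; rewrite mem_undup.
Qed.

End dirichlet_process_urn.

(** * Stick-breaking products *)

Lemma fine_tailS (R : realType) (mu : {measure set nat -> \bar R}) (t : nat) :
  (mu setT < +oo)%E ->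
  fine (mu [set s | (t < s)%N]) =
  fine (mu [set t.+1]) + fine (mu [set s | (t.+1 < s)%N]).
Proof.
move=> muT; have fin A : mu A \is a fin_num.
  rewrite ge0_fin_numE// (le_lt_trans _ muT)//.
  by apply: le_measure; rewrite ?inE.
rewrite -fineD// -measureU//; last first.
  by apply/seteqP; split => // s /= [->]; rewrite ltnn.
congr (fine (mu _)); apply/seteqP; split => s /=.
  by rewrite leq_eqVlt => /predU1P[<-|]; [left|right].
by case=> [->|/ltnW].
Qed.

Lemma pker_setT_ltey d (O : measurableType d) d' (E : measurableType d')
  (R : realType) (f : R.-pker O ~> E) w : (f w setT < +oo)%E.
Proof. by rewrite prob_kernel ltry. Qed.

Section stick_breaking.
Context {R : comNzRingType}.
Implicit Types (u : nat -> R) (s : seq nat) (M t y : nat).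

(** Exponents [0] and [1] over a range common to all factors allow several tails to be multiplied
    stick by stick. *)
Lemma prod_tail_stick u M y : (y <= M)%N ->
  \prod_(1 <= k < y.+1) (1 - u k) = \prod_(0 <= k < M) (1 - u k.+1) ^+ (k < y)%N.
Proof.
move=> yM; rewrite big_add1/= (big_cat_nat (leq0n y) yM)/=.
have -> : \prod_(y <= k < M) (1 - u k.+1) ^+ (k < y)%N = 1.
  by rewrite big_nat big1// => k /andP[yk _]; rewrite ltnNge yk.
rewrite mulr1.
by rewrite [LHS]big_nat [RHS]big_nat; apply: eq_bigr => k /andP[_ ->].
Qed.

Lemma prod_stick u M s : all (fun t => 0 < t <= M)%N s ->
  \prod_(t <- s) (u t * \prod_(1 <= k < t) (1 - u k)) =
  \prod_(0 <= k < M)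
    (u k.+1 ^+ count_mem k.+1 s * (1 - u k.+1) ^+ count (fun t => k.+1 < t)%N s).
Proof.
elim: s => [_|t s ih /= /andP[/andP[t0 tM] sM]].
  by rewrite big_nil big1// => k _; rewrite !expr0 mulr1.
rewrite big_cons ih// {ih sM}; case: t t0 tM => // t _ tM.
rewrite (prod_tail_stick _ (ltnW tM)).
have -> : u t.+1 = \prod_(0 <= k < M) u k.+1 ^+ (t.+1 == k.+1).
  rewrite (bigD1_seq t) ?iota_uniq ?mem_index_iota//= eqxx expr1 big1 ?mulr1//.
  by move=> k kt; rewrite eqSS eq_sym (negbTE kt).
rewrite -!big_split/=; apply: eq_bigr => k _.
by rewrite !exprD ltnS mulrACA.
Qed.

End stick_breaking.

(** * Urn identities for the beta-Stacy process *)

Section beta_stacy_urn.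
Context d (O : measurableType d) (R : realType) (Pr : probability O R).
Variables (U : nat -> {RV Pr >-> R}) (a b : nat -> R).
Hypothesis a0 : forall t, 0 <= a t.
Hypothesis b0 : forall t, 0 < b t.
Hypothesis indep : mutually_independent Pr (fun t => events (U t.+1)).
Hypothesis law : forall t, has_law (U t.+1) (beta_law (a t) (b t)).

Let h (p q : nat) (x : R) := `|x| ^+ p * `|1 - x| ^+ q.

Let mom M (p q : nat -> nat) :=
  (\int[Pr]_w (\prod_(0 <= k < M) h (p k) (q k) (U k.+1 w))%:E)%E.

Let momE M p q :
  (mom M p q = \prod_(0 <= k < M) \int[Pr]_w (h (p k) (q k) (U k.+1 w))%:E)%E.
Proof.
pose X (k : nat) (x : R) := (h (p k) (q k) x)%:E.
rewrite -(@expectation_prod _ _ _ Pr _ _ (fun=> R : measurableType _)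
  (fun k => U k.+1 : O -> R) X)//.
- by apply: eq_integral => w _; rewrite prodEFin.
- move=> k; apply/measurable_EFinP/measurable_funM.
    by apply: measurable_funX; exact: normr_measurable.
  apply: measurable_funX; apply: measurableT_comp; first exact: normr_measurable.
  exact: measurable_funB.
- by move=> k x; rewrite lee_fin mulr_ge0 ?exprn_ge0.
- exact: iota_uniq.
Qed.

(** By independence the moment is a product over the sticks, and only the factor of [U y.+1]
    changes. *)
Let mom_incr M p q y : (y < M)%N ->
  ((a y + b y + (p y + q y)%:R)%:E * mom M (fun k => (k == y) + p k)%N q =
   (a y + (p y)%:R)%:E * mom M p q)%E /\
  ((a y + b y + (p y + q y)%:R)%:E * mom M p (fun k => (k == y) + q k)%N =
   (b y + (q y)%:R)%:E * mom M p q)%E.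
Proof.
move=> yM; have yin : y \in index_iota 0 M by rewrite mem_index_iota.
have uM := iota_uniq 0 (M - 0).
have [incp incq] := beta_law_moment (p y) (q y) (a0 y) (b0 y) (law y).
rewrite !momE !(bigD1_seq y)//= eqxx !muleA incp incq.
by split; congr (_ * _)%E; apply: eq_bigr => k /negbTE ->.
Qed.

Variable f : R.-pker O ~> nat.
Hypothesis f0 : forall w, f w [set 0%N] = 0%E.
Hypothesis fU : {ae Pr, forall w, forall t : nat,
  f w [set s | (t < s)%N] = (\prod_(1 <= k < t.+1) (1 - U k w))%:E}.

Let fpath s y w :=
  fine (f w [set t | (y < t)%N]) * \prod_(t <- s) fine (f w [set t]).

Let mfpath s y : measurable_fun setT (fpath s y).
Proof.
have mf A : measurable_fun setT (fun w => fine (f w A)).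
  exact: (measurableT_comp (fine_measurable measurableT) (measurable_kernel f _ _)).
by apply: measurable_funM => //; exact: measurable_prod.
Qed.

Let fpath_ge0 s y w : 0 <= fpath s y w.
Proof. by rewrite mulr_ge0 ?fine_ge0//; apply: prodr_ge0 => t _; rewrite fine_ge0. Qed.

Let fpathE s y M : (y <= M)%N -> all (fun t => 0 < t <= M)%N s ->
  (\int[Pr]_w (fpath s y w)%:E = mom M (fun k => count_mem k.+1 s)
    (fun k => (k < y) + count (fun t => k.+1 < t) s)%N)%E.
Proof.
move=> yM sM; apply: ge0_ae_eq_integral => //.
- exact/measurable_EFinP.
- apply/measurable_EFinP; apply: measurable_prod => k _; apply: measurable_funM.
    apply: measurable_funX; apply: measurableT_comp; first exact: normr_measurable.
    exact: measurable_funPT.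
  apply: measurable_funX; apply: measurableT_comp; first exact: normr_measurable.
  by apply: measurable_funB => //; exact: measurable_funPT.
- by move=> w _; rewrite lee_fin.
- by move=> w _; rewrite lee_fin; apply: prodr_ge0 => k _; rewrite mulr_ge0 ?exprn_ge0.
apply: filterS fU => w fw _; congr EFin.
have atom t : (0 < t)%N ->
    fine (f w [set t]) = U t w * \prod_(1 <= k < t) (1 - U k w).
  case: t => // t _; have := fine_tailS t (pker_setT_ltey f w).
  rewrite !fw/= [X in _ + X]big_nat_recr//= => /eqP.
  by rewrite -subr_eq -[X in X - _]mulr1 -mulrBr opprB addrC subrK mulrC => /eqP.
(* The absolute values of [mom] are introduced on the product as a whole, which is nonnegative as a
   product of probabilities; no bounds on the single [U k w] are available here. *)
rewrite -(ger0_norm (fpath_ge0 s y w)) /fpath fw/= (prod_tail_stick (fun t => U t w) yM).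
have -> : \prod_(t <- s) fine (f w [set t]) =
    \prod_(t <- s) (U t w * \prod_(1 <= k < t) (1 - U k w)).
  by apply: eq_big_seq => t ts; apply: atom; case/andP: (allP sM t ts).
rewrite (prod_stick (fun t => U t w) sM) -big_split/= normr_prod; apply: eq_bigr => k _.
by rewrite mulrCA -exprD normrM !normrX.
Qed.

(** Relative to survival beyond [y], ending at [y.+1] adds one factor [U y.+1] and surviving it adds
    one factor [1 - U y.+1]. The exponents already present at that stick count the lengths in [s]
    equal to [y.+1] and those above it. *)
Lemma beta_stacy_path_urn s y : all (leq 1) s ->
  ((a y + b y + (count (leq y.+1) s)%:R)%:E *
     \int[Pr]_w (fine (f w [set y.+1]) * \prod_(t <- s) fine (f w [set t]))%:E =
   (a y + (count_mem y.+1 s)%:R)%:E *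
     \int[Pr]_w (fine (f w [set t | (y < t)%N]) *
                 \prod_(t <- s) fine (f w [set t]))%:E)%E /\
  ((a y + b y + (count (leq y.+1) s)%:R)%:E *
     \int[Pr]_w (fine (f w [set t | (y.+1 < t)%N]) *
                 \prod_(t <- s) fine (f w [set t]))%:E =
   (b y + (count (leq y.+2) s)%:R)%:E *
     \int[Pr]_w (fine (f w [set t | (y < t)%N]) *
                 \prod_(t <- s) fine (f w [set t]))%:E)%E.
Proof.
move=> s0; pose M := maxn y.+1 (\max_(t <- s) t).
have yM : (y < M)%N by rewrite leq_maxl.
have sM : all (fun t => 0 < t <= M)%N s.
  apply/allP => t ts; rewrite (allP s0)//= leq_max.
  by apply/orP; right; exact: (@leq_bigmax_seq _ s xpredT id t ts).
have countE : count (leq y.+1) s = (count_mem y.+1 s + count (leq y.+2) s)%N.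
  rewrite -count_predUI [X in (_ + X)%N](eq_count (a2 := pred0)) ?count_pred0 ?addn0.
    by apply: eq_count => t /=; rewrite leq_eqVlt eq_sym.
  by move=> t /=; apply/negbTE/negP => /andP[/eqP ->]; rewrite ltnn.
have [incp incq] := mom_incr (fun k => count_mem k.+1 s)
  (fun k => (k < y) + count (fun t => k.+1 < t) s)%N yM.
rewrite ltnn add0n -countE in incp incq.
split.
  rewrite -(fpathE (ltnW yM) sM) in incp; rewrite -incp; congr (_ * _)%E.
  have sM' : all (fun t => 0 < t <= M)%N (y.+1 :: s) by rewrite /= yM.
  (* The atom at [y.+1] is read as one more completed length, with the tail after [0], of mass [1],
     in the place of the tail factor. *)
  transitivity (\int[Pr]_w (fpath (y.+1 :: s) 0 w)%:E)%E.
    apply: eq_integral => w _; rewrite /fpath big_cons.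
    suff -> : f w [set t | (0 < t)%N] = 1%E by rewrite mul1r.
    have <- : f w ([set t | (0 < t)%N] `|` [set 0%N]) = 1%E.
      rewrite (_ : _ `|` _ = setT) ?prob_kernel//.
      by apply/seteqP; split => // -[|t] _; [right|left].
    rewrite measureU//; first by rewrite -[LHS]adde0; congr (_ + _)%E; exact/esym/f0.
    by apply/seteqP; split => // t [/= t0 tE]; move: t0; rewrite tE ltnn.
  rewrite (fpathE _ sM')//; congr mom; apply/funext => k //=.
  by rewrite eqSS eq_sym.
rewrite -(fpathE (ltnW yM) sM) in incq; rewrite -incq; congr (_ * _)%E.
rewrite -/(fpath s y.+1) (fpathE yM sM); congr mom; apply/funext => k.
by rewrite addnA ltnS leq_eqVlt; case: ltngtP.
Qed.

End beta_stacy_urn.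

(** * Independence of sub-sigma-algebras and of rows *)

Section generated_sigma_algebra.
Context d (O : measurableType d).

(** A sub-sigma-algebra is treated as the events of the identity map into [g_sigma_algebraType G],
    which makes the results on random variables applicable. *)
Lemma events_g_sigma (G : set (set O)) :
  events (fun w : O => w : g_sigma_algebraType G) = <<s G >>.
Proof.
apply/seteqP; split => [A [B mB <-]|A GA]; first by rewrite setTI.
by exists A => //; rewrite setTI.
Qed.

Lemma measurable_g_sigma_id (G : set (set O)) : G `<=` measurable ->
  measurable_fun [set: O] (fun w : O => w : g_sigma_algebraType G).
Proof.
move=> GO _ B mB; rewrite setTI.
exact: (smallest_sub (@sigma_algebra_measurable _ O) GO mB).
Qed.

Lemma measurable_fun_g_sigma d' (V : measurableType d') (G : set (set O))
    (f : O -> V) : events f `<=` <<s G >> ->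
  measurable_fun [set: g_sigma_algebraType G] (f : g_sigma_algebraType G -> V).
Proof. by move=> fG _ B mB; apply: fG; exists B. Qed.

Context (R : realType) d' (V : measurableType d').

Lemma random_measure_events_measurable (K : R.-pker O ~> V) :
  random_measure_events K `<=` measurable.
Proof.
move=> A [B mB [C mC <-]].
exact: (measurable_kernel K B mB).
Qed.

Lemma measurable_fine_kernel (K : R.-pker O ~> V) (G : set (set O)) (A : set V) :
  random_measure_events K `<=` <<s G >> -> measurable A ->
  measurable_fun [set: g_sigma_algebraType G]
    (fun w : g_sigma_algebraType G => fine (K w A)).
Proof.
move=> KG mA; apply: (measurableT_comp (fine_measurable measurableT)).
apply: (@measurable_fun_g_sigma _ _ G (fun w => K w A)) => B AB.
by apply: KG; exists A.
Qed.

End generated_sigma_algebra.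

Section independent_rows.
Context d (O : measurableType d) (R : realType) (Pr : probability O R).
Context (I : choiceType) d' (V : measurableType d') (K : I -> R.-pker O ~> V).
Hypothesis indep :
  mutually_independent Pr (fun i => <<s random_measure_events (K i) >>).

(** [C] is the product of the expectations of the rows other than [i]. It is chosen before [A],
    hence common to all the sets [A] that are compared later. *)
Lemma expectation_row_split (z : seq (I * set V)) (i : I) :
  (forall x, x \in z -> measurable x.2) ->
  exists C : \bar R, forall A : set V, measurable A ->
  (\int[Pr]_w (fine (K i w A) * \prod_(x <- z) fine (K x.1 w x.2))%:E =
   C * \int[Pr]_w (fine (K i w A) *
          \prod_(x <- z | x.1 == i) fine (K i w x.2))%:E)%E.
Proof.
move=> mz.
pose G h := random_measure_events (K h).
pose J := undup (i :: map fst z).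
pose X A h (w : g_sigma_algebraType (G h)) :=
  ((if h == i then fine (K i w A) else 1) *
   \prod_(x <- z | x.1 == h) fine (K h w x.2))%:E.
have X0 A h w : (0 <= X A h w)%E.
  rewrite lee_fin mulr_ge0//; first by case: ifP => _; rewrite ?fine_ge0.
  by apply: prodr_ge0 => x _; rewrite fine_ge0.
have mX A h : measurable A -> measurable_fun setT (X A h).
  move=> mA; apply/measurable_EFinP/measurable_funM.
    case: eqP => [->|_]; last exact: measurable_cst.
    by apply: measurable_fine_kernel => //; exact: sub_sigma_algebra.
  rewrite (_ : (fun w => _) = (fun w => \prod_(x <- z | x.1 == h) fine (K h w x.2)))//.
  under eq_fun do rewrite -big_filter.
  apply: measurable_prod => x; rewrite mem_filter => /andP[_ xz].
  by apply: measurable_fine_kernel; [exact: sub_sigma_algebra|exact: mz].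
have mphi h : measurable_fun setT (fun w : O => w : g_sigma_algebraType (G h)).
  exact/measurable_g_sigma_id/random_measure_events_measurable.
have ind : mutually_independent Pr
    (fun h => events (fun w : O => w : g_sigma_algebraType (G h))).
  by rewrite (_ : (fun _ => _) = fun h => <<s G h >>)//; apply/funext => h; rewrite events_g_sigma.
have iJ : i \in J by rewrite mem_undup mem_head.
exists (\prod_(h <- J | h != i) \int[Pr]_w X setT h w)%E => A mA.
transitivity (\int[Pr]_w (\prod_(h <- J) X A h w))%E.
  apply: eq_integral => w _; rewrite prodEFin; congr EFin.
  rewrite big_split/=; congr (_ * _).
    rewrite (bigD1_seq i) ?undup_uniq//= eqxx big1 ?mulr1//.
    by move=> h /negbTE ->.
  under [RHS]eq_bigr do rewrite big_mkcond.
  rewrite exchange_big/=; apply: eq_big_seq => x xz.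
  rewrite (bigD1_seq x.1) ?undup_uniq//=; last first.
    by rewrite mem_undup inE map_f// orbT.
  by rewrite eqxx big1 ?mulr1// => h /negbTE; rewrite eq_sym => ->.
rewrite (expectation_prod (T := fun h => g_sigma_algebraType (G h)) (X := X A))//; last 2 first.
  by move=> h; exact: mX.
  exact: undup_uniq.
rewrite (bigD1_seq i) ?undup_uniq//= muleC; congr (_ * _)%E; last first.
  by apply: eq_integral => w _; rewrite /X eqxx.
by apply: eq_bigr => h /negbTE hi; rewrite /X hi.
Qed.

End independent_rows.

Section independent_product.
Context d (O : measurableType d) (R : realType) (Pr : probability O R).
Local Open Scope ereal_scope.

Lemma expectation_mul (G1 G2 : set (set O)) (X Y : O -> \bar R) :
  G1 `<=` measurable -> G2 `<=` measurable ->
  (forall A B, <<s G1 >> A -> <<s G2 >> B -> Pr (A `&` B) = Pr A * Pr B) ->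
  measurable_fun [set: g_sigma_algebraType G1] (X : g_sigma_algebraType G1 -> \bar R) ->
  measurable_fun [set: g_sigma_algebraType G2] (Y : g_sigma_algebraType G2 -> \bar R) ->
  (forall w, 0 <= X w) -> (forall w, 0 <= Y w) ->
  \int[Pr]_w (X w * Y w) = (\int[Pr]_w X w) * \int[Pr]_w Y w.
Proof.
move=> mG1 mG2 ind mX mY X0 Y0.
have mid1 := measurable_g_sigma_id mG1.
have mid2 := measurable_g_sigma_id mG2.
have mX' : measurable_fun [set: O] X := measurableT_comp mX mid1.
have mY' : measurable_fun [set: O] Y := measurableT_comp mY mid2.
have meas (G : set (set O)) A : G `<=` measurable -> <<s G >> A -> measurable A.
  by move=> GO; apply: (smallest_sub (@sigma_algebra_measurable _ O) GO).
have EY0 : 0 <= \int[Pr]_w Y w by exact: integral_ge0.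
transitivity (\int[Pr]_w (X w * cst (\int[Pr]_w Y w) w)); last exact: ge0_integralZr.
apply: (ge0_integral_agree
  (phi1 := fun w : O => w : g_sigma_algebraType G1)
  (phi2 := fun w : O => w : g_sigma_algebraType G1) (X := X)) => // A mA.
have mAO := meas _ _ mG1 mA.
have mIA : measurable_fun [set: O] (fun w => (\1_A w : R)%:E).
  exact/measurable_EFinP/measurable_indic.
rewrite ge0_integralZr//.
rewrite integral_indic// setIT.
transitivity (\int[Pr]_w (Y w * (\1_A w)%:E)).
  by apply: eq_integral => w _; rewrite muleC.
transitivity (\int[Pr]_w (Y w * cst (Pr A) w)); last first.
  by rewrite ge0_integralZr// muleC.
apply: (ge0_integral_agree
  (phi1 := fun w : O => w : g_sigma_algebraType G2)
  (phi2 := fun w : O => w : g_sigma_algebraType G2) (X := Y)) => // B mB; have mBO := meas _ _ mG2 mB.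
have mIB : measurable_fun [set: O] (fun w => (\1_B w : R)%:E).
  exact/measurable_EFinP/measurable_indic.
rewrite ge0_integralZr//.
rewrite integral_indic// setIT muleC -ind// -[in RHS](setIT (A `&` B)).
rewrite -integral_indic; [|by []|exact: measurableI].
by apply: eq_integral => w _; rewrite setIC indicI.
Qed.

End independent_product.

Lemma addIe_fin (R : realDomainType) (z x y : \bar R) : z \is a fin_num ->
  (x + z = y + z -> x = y)%E.
Proof. by move=> zf /(congr1 (fun u => u - z)%E); rewrite !addeK. Qed.

Lemma addeI_fin (R : realDomainType) (z x y : \bar R) : z \is a fin_num ->
  (z + x = z + y -> x = y)%E.
Proof. by rewrite ![(z + _)%E]addeC; exact: addIe_fin. Qed.

(** * Probabilities of renewal paths *)

Section path_events.
Context d (O : measurableType d) (R : realType) (Pr : probability O R).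
Context dE (E : measurableType dE).
Hypothesis E_discrete : forall A : set E, measurable A.
Variables (L : nat -> {RV Pr >-> E}) (T : nat -> {RV Pr >-> nat}).
Variables (l : nat -> E) (tau : nat -> nat).

Definition path_event n : set O :=
  [set w | (forall k, (k <= n)%N -> L k w = l k) /\
           (forall k, (k < n)%N -> T k w = tau k)].

Lemma path_eventS n : path_event n.+1 =
  path_event n `&` [set w | L n.+1 w = l n.+1 /\ T n w = tau n].
Proof.
apply/seteqP; split => [w [Lw Tw]|w [[Lw Tw] [Lnw Tnw]]].
  split; last by split; [exact: Lw|exact: Tw].
  by split => k kn; [apply: Lw|apply: Tw]; rewrite (leq_trans kn).
split => k; first by rewrite leq_eqVlt => /predU1P[->//|]; exact: Lw.
by rewrite ltnS leq_eqVlt => /predU1P[->//|]; exact: Tw.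
Qed.

Lemma measurable_path_event n : measurable (path_event n).
Proof.
elim: n => [|n ih].
  rewrite (_ : path_event 0 = L 0%N @^-1` [set l 0%N]).
    by rewrite -[X in measurable X]setTI; exact: measurable_funPT.
  apply/seteqP; split => w; first by case=> + _; exact.
  by move=> Lw; split => // k; rewrite leqn0 => /eqP ->.
rewrite path_eventS (_ : [set w | _] =
    (L n.+1 @^-1` [set l n.+1]) `&` (T n @^-1` [set tau n]))//.
by apply: measurableI => //; apply: measurableI;
  rewrite -[X in measurable X]setTI; exact: measurable_funPT.
Qed.

End path_events.

Section markov_renewal_paths.
Context d (O : measurableType d) (R : realType) (Pr : probability O R).
Context dE (E : measurableType dE).
Hypothesis E_countable : countable [set: E].
Hypothesis E_discrete : forall A : set E, measurable A.
Variables (P : E -> R.-pker O ~> E) (F : E -> R.-pker O ~> nat).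
Hypothesis PF : characteristic_couple P F.
Variables (L : nat -> {RV Pr >-> E}) (T : nat -> {RV Pr >-> nat}).
Hypothesis T_gt0 : forall n w, (0 < T n w)%N.
Hypothesis LT : forall (n t : nat) (j : E), (0 < t)%N ->
  cond_prob_eq Pr (renewal_history P F L T n)
    [set w | L n.+1 w = j /\ (T n w <= t)%N]
    (fun w => fine (F (L n w) w [set s | (s <= t)%N])
              * fine (P (L n w) w [set j])).

Let fP i A w := fine (P i w A).
Let fF i A w := fine (F i w A).

Definition couple_events : set (set O) :=
  (\bigcup_i random_measure_events (P i)) `|` (\bigcup_i random_measure_events (F i)).

Lemma couple_events_measurable : couple_events `<=` measurable.
Proof.
move=> A [] [i _]; exact: random_measure_events_measurable.
Qed.

Variables (l : nat -> E) (tau : nat -> nat).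

Local Notation path_event := (path_event L T l tau).

Let history_measurable n : renewal_history P F L T n `<=` measurable.
Proof.
apply: smallest_sub; first exact: sigma_algebra_measurable.
move=> A [[[|]|]|] [i _].
- exact: random_measure_events_measurable.
- exact: random_measure_events_measurable.
- by move=> [B mB <-]; exact: measurable_funPT.
- by move=> [B mB <-]; exact: measurable_funPT.
Qed.

Let path_event_history n : renewal_history P F L T n (path_event n).
Proof.
have -> : path_event n =
    \bigcap_(k in `I_n.+1) (L k @^-1` [set l k]) `&`
    \bigcap_(k in `I_n) (T k @^-1` [set tau k]).
  by apply/seteqP; split => w [Lw Tw]; split => k /= kn; [exact: Lw|exact: Tw|exact: Lw|exact: Tw].
pose H := ((\bigcup_i random_measure_events (P i))
      `|` (\bigcup_i random_measure_events (F i))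
      `|` (\bigcup_(k in [set k | (k <= n)%N]) events (L k))
      `|` (\bigcup_(k in [set k | (k < n)%N]) events (T k))).
rewrite -[renewal_history P F L T n]/(H.-sigma.-measurable).
apply: measurableI; apply: fin_bigcap_measurable => //; try exact: finite_II.
- move=> k /= kn; apply: sub_sigma_algebra; left; right; exists k => //.
  by exists [set l k] => //; rewrite setTI.
- move=> k /= kn; apply: sub_sigma_algebra; right; exists k => //.
  by exists [set tau k] => //; rewrite setTI.
Qed.

Let mfP i A : measurable_fun setT (fP i A).
Proof.
exact: (measurableT_comp (fine_measurable measurableT) (measurable_kernel (P i) _ _)).
Qed.

Let mfF i A : measurable_fun setT (fF i A).
Proof.
exact: (measurableT_comp (fine_measurable measurableT) (measurable_kernel (F i) _ _)).
Qed.

Let fP0 i A w : 0 <= fP i A w. Proof. exact: fine_ge0. Qed.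
Let fF0 i A w : 0 <= fF i A w. Proof. exact: fine_ge0. Qed.

Let mT n (A : set nat) : measurable [set w | A (T n w)].
Proof.
by rewrite -[[set w | _]]/(T n @^-1` A) -[X in measurable X]setTI; exact: measurable_funPT.
Qed.

Let mL n (A : set E) : measurable [set w | A (L n w)].
Proof.
rewrite -[[set w | _]]/(L n @^-1` A) -[X in measurable X]setTI.
exact: measurable_funPT.
Qed.

(** On [B] the state [L n] is constant, so the random row indices in [LT] become the fixed row
    [l n]. At [t = 0], which [LT] leaves out, both sides vanish. *)
Let renewal_cdf n t j B : renewal_history P F L T n B ->
  B `<=` [set w | L n w = l n] ->
  Pr ([set w | L n.+1 w = j /\ (T n w <= t)%N] `&` B) =
  (\int[Pr]_(w in B) (fF (l n) [set s | (s <= t)%N] w * fP (l n) [set j] w)%:E)%E.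
Proof.
move=> hB Bl; have mB := history_measurable hB.
case: t => [|t].
  rewrite (_ : _ `&` _ = set0) ?measure0; last first.
    apply/seteqP; split => // w [[_]] /=.
    by rewrite leqNgt T_gt0.
  rewrite integral0_eq// => w _; rewrite /fF.
  rewrite (_ : [set s | (s <= 0)%N] = [set 0%N]); last first.
    by apply/seteqP; split => s /=; [rewrite leqn0 => /eqP|move=> ->].
  by rewrite (PF w (l n)).2 mul0r.
have [g [_ ig Eg fg]] := LT n j (ltn0Sn t).
rewrite -(Eg B hB); apply: ae_eq_integral => //.
- exact: measurable_funTS (measurable_int _ ig).
- by apply: measurable_funTS; apply/measurable_EFinP/measurable_funM.
- apply: filterS fg => w fgw Bw.
  by rewrite -fgw (Bl _ Bw).
Qed.

Let fFS i t w : fF i [set s | (s <= t.+1)%N] w =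
  fF i [set t.+1] w + fF i [set s | (s <= t)%N] w.
Proof.
rewrite /fF -fineD; last 2 first.
- by rewrite ge0_fin_numE// (le_lt_trans _ (pker_setT_ltey (F i) w))// le_measure// inE.
- by rewrite ge0_fin_numE// (le_lt_trans _ (pker_setT_ltey (F i) w))// le_measure// inE.
rewrite -measureU//; last first.
  by apply/seteqP; split => // s [/= -> ]; rewrite ltnn.
congr (fine (F i w _)); apply/seteqP; split => s /=.
  by rewrite leq_eqVlt => /predU1P[->|]; [left|right].
by case=> [->//|st]; exact: leqW.
Qed.

Let renewal_pmf n t j B : renewal_history P F L T n B ->
  B `<=` [set w | L n w = l n] ->
  Pr ([set w | L n.+1 w = j /\ T n w = t] `&` B) =
  (\int[Pr]_(w in B) (fF (l n) [set t] w * fP (l n) [set j] w)%:E)%E.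
Proof.
move=> hB Bl; have mB := history_measurable hB.
case: t => [|t].
  rewrite (_ : _ `&` _ = set0) ?measure0; last first.
    by apply/seteqP; split => // w [[_ /= T0]]; have := T_gt0 n w; rewrite T0.
  by rewrite integral0_eq// => w _; rewrite /fF (PF w (l n)).2 mul0r.
have mLT (A : set nat) : measurable ([set w | L n.+1 w = j /\ A (T n w)] `&` B).
  apply: measurableI => //; rewrite -[X in measurable X]/(
    [set w | [set j] (L n.+1 w)] `&` [set w | A (T n w)]).
  exact: measurableI.
have mI A : measurable_fun B (fun w => (fF (l n) A w * fP (l n) [set j] w)%:E).
  by apply: measurable_funTS; apply/measurable_EFinP/measurable_funM.
have I0 A w : B w -> (0 <= (fF (l n) A w * fP (l n) [set j] w)%:E)%E.
  by move=> _; rewrite lee_fin mulr_ge0.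
have := renewal_cdf t.+1 j hB Bl.
rewrite (_ : _ `&` B = ([set w | L n.+1 w = j /\ T n w = t.+1] `&` B) `|`
    ([set w | L n.+1 w = j /\ (T n w <= t)%N] `&` B)); last first.
  apply/seteqP; split => w.
    move=> [[Lj]]; rewrite leq_eqVlt => /predU1P[Tt|Tt] Bw; first by left.
    by right.
  by case=> -[[Lj Tt] Bw]; split=> //; split=> //; [rewrite Tt|exact: leqW].
rewrite measureU; [|exact: (mLT [set t.+1])|exact: (mLT [set s | (s <= t)%N])|]; last first.
  by apply/seteqP; split => // w [[[_ Tt] _] [[_]]]; rewrite Tt ltnn.
under eq_integral do rewrite fFS mulrDl EFinD.
rewrite ge0_integralD//; [|exact: I0..].
rewrite -renewal_cdf//; apply: addIe_fin.
by apply: fin_num_measure; exact: (mLT [set s | (s <= t)%N]).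
Qed.

(** [LT] gives the law of [T n] only jointly with the next state: summing over the countable [E]
    removes that state, since a row has total mass [1], and complementation turns the result into a
    tail. *)
Let renewal_tail n y B : renewal_history P F L T n B ->
  B `<=` [set w | L n w = l n] ->
  Pr ([set w | (y < T n w)%N] `&` B) =
  (\int[Pr]_(w in B) (fF (l n) [set s | (y < s)%N] w)%:E)%E.
Proof.
move=> hB Bl; have mB := history_measurable hB.
have [e einj] := countable_injP _ E_countable.
(* States are enumerated by their codes; each [D k] is a singleton or empty. *)
pose D k := [set x | e x = k].
have mLT k : measurable ([set w | e (L n.+1 w) = k /\ (T n w <= y)%N] `&` B).
  apply: measurableI => //; rewrite -[X in measurable X]/(
    [set w | D k (L n.+1 w)] `&` [set w | [set s | (s <= y)%N] (T n w)]).
  exact: measurableI.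
have cdfD k : Pr ([set w | e (L n.+1 w) = k /\ (T n w <= y)%N] `&` B) =
    (\int[Pr]_(w in B) (fF (l n) [set s | (s <= y)%N] w * fP (l n) (D k) w)%:E)%E.
  have [[j ejk]|nk] := pselect (exists j, e j = k); last first.
    rewrite (_ : _ `&` B = set0) ?measure0; last first.
      by apply/seteqP; split => // w [[ek _] _]; apply: nk; exists (L n.+1 w).
    rewrite integral0_eq// => w _; rewrite /fP (_ : D k = set0) ?measure0 ?mulr0//.
    by apply/seteqP; split => // x ek; apply: nk; exists x.
  have eqj x : e x = k -> x = j by rewrite -ejk => /einj; apply; rewrite inE.
  have -> : D k = [set j] by apply/seteqP; split => x /=; [exact: eqj|move=> ->].
  rewrite -renewal_cdf//; congr (Pr (_ `&` _)).
  by apply/seteqP; split => w [/= Lw Tw]; split=> //; [exact: eqj|rewrite Lw].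
have mI A C : measurable_fun B (fun w => (fF (l n) A w * fP (l n) C w)%:E).
  by apply: measurable_funTS; apply/measurable_EFinP/measurable_funM.
have cdf : Pr ([set w | (T n w <= y)%N] `&` B) =
    (\int[Pr]_(w in B) (fF (l n) [set s | (s <= y)%N] w)%:E)%E.
  rewrite (_ : _ `&` B = \bigcup_k ([set w | e (L n.+1 w) = k /\ (T n w <= y)%N] `&` B)); last first.
    apply/seteqP; split => w; first by move=> [Ty Bw]; exists (e (L n.+1 w)).
    by move=> [k _ [[_ Ty] Bw]].
  rewrite measure_bigcup//; last first.
    by move=> k k' _ _ [w [[[<- _] _] [[<- _] _]]].
  under eq_eseriesl do rewrite in_setT.
  rewrite (eq_eseriesr (fun k _ => cdfD k)).
  rewrite -integral_nneseries//; last by move=> k w _; rewrite lee_fin mulr_ge0.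
  apply: eq_integral => w _.
  under eq_eseriesr do rewrite EFinM.
  rewrite nneseriesZl//; last by move=> k _; rewrite lee_fin.
  rewrite -[RHS]mule1; congr (_ * _)%E.
  transitivity (P (l n) w setT); last exact: prob_kernel.
  rewrite (_ : setT = \bigcup_k D k); last first.
    by apply/seteqP; split => // x _; exists (e x).
  rewrite measure_bigcup//; last by move=> k k' _ _ [x [<- <-]].
  under [RHS]eq_eseriesl do rewrite in_setT.
  apply: eq_eseriesr => k _; rewrite /fP fineK// ge0_fin_numE//.
  rewrite (le_lt_trans _ (pker_setT_ltey (P (l n)) w))//.
  by apply: le_measure => //; rewrite inE; exact: E_discrete.
have tot : (Pr B = \int[Pr]_(w in B) (fF (l n) [set s | (s <= y)%N] w)%:E +
    \int[Pr]_(w in B) (fF (l n) [set s | (y < s)%N] w)%:E)%E.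
  have mF A : measurable_fun B (fun w => (fF (l n) A w)%:E).
    by apply: measurable_funTS; apply/measurable_EFinP.
  have F0 A w : B w -> (0 <= (fF (l n) A w)%:E)%E.
    by move=> _; rewrite lee_fin.
  rewrite -ge0_integralD//; [|exact: F0..].
  rewrite -[LHS]mul1e -[in LHS]integral_cst//; apply: eq_integral => w _.
  rewrite -EFinD /fF -fineD; last 2 first.
  - by rewrite ge0_fin_numE// (le_lt_trans _ (pker_setT_ltey (F (l n)) w))// le_measure// inE.
  - by rewrite ge0_fin_numE// (le_lt_trans _ (pker_setT_ltey (F (l n)) w))// le_measure// inE.
  rewrite -measureU//; last first.
    by apply/seteqP; split => // s [/=]; rewrite leqNgt => /negP.
  have -> : [set s | (s <= y)%N] `|` [set s | (y < s)%N] = setT.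
    by apply/seteqP; split => // s _ /=; case: (leqP s y); [left|right].
  congr EFin; transitivity (fine (1%E : \bar R)) => //; congr fine.
  exact/esym/prob_kernel.
have TB : (Pr B = Pr ([set w | (T n w <= y)%N] `&` B) +
    Pr ([set w | (y < T n w)%N] `&` B))%E.
  rewrite -measureU; [|exact: measurableI (mT n [set s | (s <= y)%N]) mB
    |exact: measurableI (mT n [set s | (y < s)%N]) mB|].
    congr (Pr _); apply/seteqP; split => w; last by case=> -[].
    by move=> Bw; case: (leqP (T n w) y) => Ty; [left|right].
  by apply/seteqP; split => // w [[/= Ty _] [/= yT _]]; move: yT; rewrite ltnNge Ty.
move: tot; rewrite -cdf TB; apply: addeI_fin.
by apply: fin_num_measure; exact: measurableI (mT n [set s | (s <= y)%N]) mB.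
Qed.

Let WF n w := \prod_(k < n) fF (l k) [set tau k] w.
Let WP n w := \prod_(k < n) fP (l k) [set l k.+1] w.

Local Notation couple_measurable Y :=
  (measurable_fun [set: g_sigma_algebraType couple_events]
    (Y : g_sigma_algebraType couple_events -> \bar R)).

Let mfFc i A : couple_measurable (fun w => (fF i A w)%:E).
Proof.
apply/measurable_EFinP; apply: measurable_fine_kernel => //.
by move=> B KB; apply: sub_sigma_algebra; right; exists i.
Qed.

Let mfPc i A : couple_measurable (fun w => (fP i A w)%:E).
Proof.
apply/measurable_EFinP; apply: measurable_fine_kernel => //.
by move=> B KB; apply: sub_sigma_algebra; left; exists i.
Qed.

Let mcoupleO (Y : O -> \bar R) : couple_measurable Y -> measurable_fun setT Y.
Proof.
move=> mY; exact: (measurableT_comp mY (measurable_g_sigma_id couple_events_measurable)).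
Qed.

Let mpath := measurable_path_event E_discrete L T l tau.

Let mIpath n : measurable_fun setT (fun w => (\1_(path_event n) w : R)%:E).
Proof. exact/measurable_EFinP/measurable_indic/mpath. Qed.

(** Events of the couple belong to every renewal history, so the last step can be integrated out
    against any [Y] depending on the couple only. In [path_law] this freedom lets [Y] absorb the
    factor just produced. *)
Let path_step n (Y : O -> \bar R) : (forall w, 0 <= Y w)%E ->
  couple_measurable Y ->
  (\int[Pr]_w (Y w * (\1_(path_event n.+1) w)%:E) =
   \int[Pr]_w ((Y w * (fF (l n) [set tau n] w * fP (l n) [set l n.+1] w)%:E)
                * (\1_(path_event n) w)%:E))%E.
Proof.
move=> Y0 mY.
have mFP : measurable_fun setT
    (fun w => (fF (l n) [set tau n] w * fP (l n) [set l n.+1] w)%:E).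
  by apply/measurable_EFinP/measurable_funM.
transitivity (\int[Pr]_w (Y w *
  ((fF (l n) [set tau n] w * fP (l n) [set l n.+1] w)%:E * (\1_(path_event n) w)%:E)))%E;
  last by apply: eq_integral => w _; rewrite muleA.
apply: (ge0_integral_agree
  (phi1 := fun w : O => w : g_sigma_algebraType couple_events)
  (phi2 := fun w : O => w : g_sigma_algebraType couple_events) (X := Y)) => //.
- exact: measurable_g_sigma_id couple_events_measurable.
- exact: measurable_g_sigma_id couple_events_measurable.
- exact: emeasurable_funM.
- by move=> w; rewrite mule_ge0// lee_fin ?mulr_ge0.
move=> A mA.
have sA : <<s couple_events >> A := mA.
have mAO : @measurable _ O A.
  have := measurable_g_sigma_id couple_events_measurable measurableT mA.
  by rewrite setTI.
have hA : renewal_history P F L T n A.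
  have sub : <<s couple_events >> `<=` renewal_history P F L T n.
    by apply: sub_sigma_algebra2 => B cB; do 2 left.
  exact: sub.
have hB : renewal_history P F L T n (path_event n `&` A).
  exact: (@measurableI _ (g_sigma_algebraType _) _ _ (@path_event_history n) hA).
have Bl : path_event n `&` A `<=` [set w | L n w = l n].
  by move=> w [[Lw _] _]; exact: Lw.
transitivity (Pr (path_event n.+1 `&` A)).
  rewrite -[in RHS](setIT (_ `&` A)) -integral_indic; [|by []|exact: measurableI].
  apply: eq_integral => w _; rewrite -EFinM.
  by rewrite (setIC (path_event _) A) [in RHS]indicI.
rewrite path_eventS -setIA setICA (renewal_pmf _ _ hB Bl) [LHS]integral_mkcond.
apply: eq_integral => w _; rewrite patchE (in_setI w (path_event n) A) !indicE.
by case: (w \in path_event n); case: (w \in A); rewrite ?mule1 ?mul1e ?mule0 ?mul0e.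
Qed.

Let path_law n (Y : O -> \bar R) : (forall w, 0 <= Y w)%E ->
  couple_measurable Y ->
  (\int[Pr]_w (Y w * (\1_(path_event n) w)%:E) =
   \int[Pr]_w ((Y w * (WF n w * WP n w)%:E) * (\1_(path_event 0) w)%:E))%E.
Proof.
elim: n Y => [|n ih] Y Y0 mY.
  by apply: eq_integral => w _; rewrite /WF /WP !big_ord0 mulr1 mule1.
rewrite path_step// ih.
- apply: eq_integral => w _; rewrite /WF /WP !big_ord_recr/= -!muleA.
  by congr (_ * _)%E; rewrite -!EFinM; congr EFin; ring.
- by move=> w; rewrite mule_ge0// lee_fin mulr_ge0.
- by apply: emeasurable_funM => //; under eq_fun do rewrite EFinM; exact: emeasurable_funM.
Qed.

Hypothesis L0 : {ae Pr, forall w, L 0%N w = l 0%N}.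

Let WF0 n w : 0 <= WF n w. Proof. exact: prodr_ge0. Qed.
Let WP0 n w : 0 <= WP n w. Proof. exact: prodr_ge0. Qed.

Let path_law_init n (Y : O -> \bar R) : (forall w, 0 <= Y w)%E ->
  couple_measurable Y ->
  (\int[Pr]_(w in path_event n) Y w = \int[Pr]_w (Y w * (WF n w * WP n w)%:E))%E.
Proof.
move=> Y0 mY; have mYO := mcoupleO mY.
have mW : measurable_fun setT (fun w => (WF n w * WP n w)%:E).
  by apply/measurable_EFinP/measurable_funM; apply: measurable_prod.
transitivity (\int[Pr]_w (Y w * (\1_(path_event n) w)%:E))%E.
  rewrite integral_mkcond; apply: eq_integral => w _.
  by rewrite patchE indicE; case: (w \in _); rewrite ?mule1 ?mule0.
rewrite path_law//; apply: ge0_ae_eq_integral => //.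
- by apply: emeasurable_funM => //; exact: emeasurable_funM.
- exact: emeasurable_funM.
- by move=> w _; rewrite !mule_ge0// lee_fin ?mulr_ge0.
- by move=> w _; rewrite mule_ge0// lee_fin mulr_ge0.
apply: filterS L0 => w Lw _; rewrite indicE mem_set ?mule1//.
by split=> // k; rewrite leqn0 => /eqP ->.
Qed.

Lemma path_event_jump n t j :
  (Pr (path_event n `&` [set w | L n.+1 w = j /\ T n w = t]) =
   \int[Pr]_w ((fine (F (l n) w [set t]) * \prod_(k < n) fine (F (l k) w [set tau k]))
            * (fine (P (l n) w [set j]) * \prod_(k < n) fine (P (l k) w [set l k.+1])))%:E)%E.
Proof.
rewrite setIC (renewal_pmf _ _ (@path_event_history n)); last by move=> w [Lw _]; exact: Lw.
rewrite (path_law_init n (Y := fun w => (fF (l n) [set t] w * fP (l n) [set j] w)%:E)).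
- by apply: eq_integral => w _; rewrite -EFinM mulrACA.
- by move=> w; rewrite lee_fin mulr_ge0.
- by under eq_fun do rewrite EFinM; exact: emeasurable_funM.
Qed.

Lemma path_event_stay n y :
  (Pr (path_event n `&` [set w | (y < T n w)%N]) =
   \int[Pr]_w ((fine (F (l n) w [set s | (y < s)%N]) *
                  \prod_(k < n) fine (F (l k) w [set tau k]))
            * \prod_(k < n) fine (P (l k) w [set l k.+1]))%:E)%E.
Proof.
rewrite setIC (renewal_tail _ (@path_event_history n)); last by move=> w [Lw _]; exact: Lw.
rewrite (path_law_init n (Y := fun w => (fF (l n) [set s | (y < s)%N] w)%:E)) => //.
- by apply: eq_integral => w _; rewrite -EFinM mulrA.
- by move=> w; rewrite lee_fin.
Qed.

Lemma self_jump_null n t :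
  Pr ([set w | L n.+1 w = l n /\ (T n w <= t)%N] `&` [set w | L n w = l n]) = 0%E.
Proof.
rewrite renewal_cdf//.
  by rewrite integral0_eq// => w _; rewrite /fP (PF w (l n)).1 mulr0.
apply: sub_sigma_algebra; left; right; exists n => //=.
by exists [set l n] => //; rewrite setTI.
Qed.

End markov_renewal_paths.

(** A self-jump has probability zero because [P] has zero diagonal. The event is split by the code
    of [L n] and by a bound on [T n], since [markov_renewal] only gives probabilities joint with
    [T n <= t]. *)
Lemma consecutive_states_neq d (O : measurableType d) (R : realType)
    (Pr : probability O R) dE (E : measurableType dE)
    (P : E -> R.-pker O ~> E) (F : E -> R.-pker O ~> nat)
    (l0 : E) (L : nat -> {RV Pr >-> E}) (T : nat -> {RV Pr >-> nat}) :
  countable [set: E] -> (forall A : set E, measurable A) ->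
  characteristic_couple P F -> markov_renewal l0 P F L T ->
  {ae Pr, forall w, forall n, L n.+1 w <> L n w}.
Proof.
move=> E_countable E_discrete PF [T_gt0 _ LT].
have [e einj] := countable_injP _ E_countable.
apply/ae_foralln => n.
suff ae k t : {ae Pr, forall w,
    ~ ((L n.+1 w = L n w /\ (T n w <= t)%N) /\ e (L n w) = k)}.
  have : {ae Pr, forall w, forall k t,
      ~ ((L n.+1 w = L n w /\ (T n w <= t)%N) /\ e (L n w) = k)}.
    by apply/ae_foralln => k; apply/ae_foralln => t; exact: ae.
  by apply: filterS => w h Lw; apply: (h (e (L n w)) (T n w)).
have [[j ejk]|nk] := pselect (exists j, e j = k); last first.
  by apply: aeW => w [_ ek]; apply: nk; exists (L n w).
exists ([set w | L n.+1 w = j /\ (T n w <= t)%N] `&` [set w | L n w = j]); split.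
- have mL k' : measurable [set w | L k' w = j].
    rewrite -[[set w | _]]/(L k' @^-1` [set j]) -[X in measurable X]setTI.
    exact: measurable_funPT.
  have mT : measurable [set w | (T n w <= t)%N].
    rewrite -[[set w | _]]/(T n @^-1` [set s | (s <= t)%N]) -[X in measurable X]setTI.
    exact: measurable_funPT.
  apply: measurableI => //; exact: measurableI (mL n.+1) mT.
- exact: (self_jump_null E_discrete PF T_gt0 LT (fun=> j)).
- move=> w /= /contrapT[[Lw Tw] ek].
  have Lj : L n w = j by apply: einj; rewrite ?inE// ek ejk.
  by split=> //; rewrite Lw.
Qed.

(** * Jump times and trajectory statistics *)

Section jump_times.
Variable T : nat -> nat.
Hypothesis T_gt0 : forall n, (0 < T n)%N.
Local Open Scope nat_scope.

Lemma jump_timeS n : jump_time T n.+1 = jump_time T n + T n.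
Proof. by rewrite /jump_time big_ord_recr. Qed.

Lemma jump_time0 : jump_time T 0 = 0.
Proof. by rewrite /jump_time big_ord0. Qed.

Lemma leq_jump_time n : n <= jump_time T n.
Proof.
elim: n => // n ih; rewrite jump_timeS -addn1.
by apply: leq_add.
Qed.

Lemma jump_time_mono m n : (jump_time T m <= jump_time T n) = (m <= n).
Proof.
have lt k : jump_time T k < jump_time T k.+1 by rewrite jump_timeS -addn1 leq_add2l.
exact: (leq_mono (homo_ltn ltn_trans lt)).
Qed.

Lemma num_jumps_eq n t : jump_time T n <= t < jump_time T n.+1 ->
  num_jumps T t = n.
Proof.
move=> /andP[nt tn].
have JE m : (jump_time T m <= t) = (m <= n).
  apply/idP/idP => [mt|]; last by rewrite -jump_time_mono => /leq_trans; exact.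
  by rewrite -ltnS ltnNge -jump_time_mono -ltnNge (leq_ltn_trans mt).
(* Holding times are at least [1], so the jump time of index [m] is at least [m] and no index above
   [t] contributes. *)
rewrite /num_jumps (fsbigE (index_iota 1 t.+1)) ?iota_uniq//=; last 2 first.
- by move=> m /=; rewrite mem_index_iota => /andP[].
- move=> m m1; rewrite mem_index_iota m1/= ltnS => mt; rewrite JE.
  have -> // : (m <= n) = false.
  by apply/negbTE; move: mt; apply: contraNN => /leq_trans; apply; exact: leq_trans (leq_jump_time n) nt.
rewrite big_mkcond/= big_nat (eq_bigr (fun m => (m <= n) : nat)); last first.
  by move=> m /andP[m1 _]; rewrite ifT ?JE// inE.
have nt1 : n.+1 <= t.+1 by rewrite ltnS (leq_trans (leq_jump_time n)).
rewrite -big_nat (big_cat_nat (ltn0Sn n) nt1)/=.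
rewrite [X in _ + X]big_nat [X in _ + X]big1 ?addn0; last first.
  by move=> m /andP[nm _]; rewrite leqNgt nm.
rewrite big_nat (eq_bigr (fun=> 1)); last first.
  by move=> m /andP[_]; rewrite ltnS => ->.
by rewrite -big_nat sum_nat_const_nat muln1 subn1.
Qed.

Lemma num_jumpsP t :
  jump_time T (num_jumps T t) <= t < jump_time T (num_jumps T t).+1.
Proof.
suff [n nt] : exists n, jump_time T n <= t < jump_time T n.+1.
  by rewrite (num_jumps_eq nt) nt.
elim: t => [|t [n /andP[nt tn]]].
  by exists 0; rewrite jump_timeS jump_time0 add0n T_gt0.
have [tn1|] := ltnP t.+1 (jump_time T n.+1).
  by exists n; rewrite tn1 (leq_trans nt).
move=> nt1; have eq : jump_time T n.+1 = t.+1 by apply/eqP; rewrite eqn_leq nt1.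
by exists n.+1; rewrite (jump_timeS n.+1) eq leqnn/= -[ltnLHS]addn0 ltn_add2l.
Qed.

Lemma num_jumpsS t : num_jumps T t.+1 =
  num_jumps T t + (jump_time T (num_jumps T t).+1 == t.+1).
Proof.
set n := num_jumps T t; have /andP[nt tn] := num_jumpsP t.
apply: num_jumps_eq; case: eqP => [eq|/eqP neq].
  by rewrite addn1 (jump_timeS n.+1) eq leqnn/= -[ltnLHS]addn0 ltn_add2l.
by rewrite addn0 (leq_trans nt)//= ltn_neqAle eq_sym neq.
Qed.

End jump_times.

Section trajectories.
Variables (E : choiceType) (L : nat -> E) (T : nat -> nat).
Hypothesis T_gt0 : forall n, (0 < T n)%N.
Local Open Scope nat_scope.
Let S := semi_markov L T.
Let N := num_jumps T.
Let J := jump_time T.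

(** One time step contains at most one jump, and a step without jump contributes nothing because
    [i != j]. *)
Lemma num_transitions_jumps i j t : i != j ->
  num_transitions S i j t = \sum_(k < N t) ((L k == i) && (L k.+1 == j)).
Proof.
move=> ij; rewrite /num_transitions big_add1/=; elim: t => [|t ih].
  rewrite big_geq// /N (num_jumps_eq T_gt0 (n := 0)) ?big_ord0//.
  by rewrite jump_timeS jump_time0 add0n T_gt0.
rewrite big_nat_recr//= ih /S /semi_markov /N num_jumpsS//.
case: (_ =P t.+1) => _; first by rewrite addn1 big_ord_recr.
rewrite addn0; case: eqP => [->|_]; last by rewrite addn0.
by rewrite (negbTE ij) addn0.
Qed.

Hypothesis L_neq : forall n, L n.+1 <> L n.

(** Every completed visit to [i] ends in exactly one state other than [i]. The list [r] of the
    destinations that occur carries the whole sum. *)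
Lemma sum_num_transitions i t :
  \big[addn/0]_(h \in [set h | h != i]) num_transitions S i h t =
  \sum_(k < N t) (L k == i).
Proof.
pose r := [seq h <- undup [seq L k.+1 | k <- iota 0 (N t)] | h != i].
have ur : uniq r by rewrite filter_uniq// undup_uniq.
rewrite (fsbigE r)//; last 2 first.
- by move=> h /=; rewrite mem_filter => /andP[].
- move=> h /= hi; rewrite mem_filter hi/= mem_undup => hr.
  rewrite num_transitions_jumps 1?eq_sym// big1// => k _.
  apply/eqP; rewrite eqb0; apply: contraNN hr => /andP[_ /eqP <-].
  by apply: map_f; rewrite mem_iota/= add0n.
rewrite big_mkcond/= (eq_big_seq (fun h => \sum_(k < N t) ((L k == i) && (L k.+1 == h)))).
  rewrite exchange_big/=; apply: eq_bigr => k _.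
  have [Lk|_] := eqVneq (L k) i; last by rewrite big1.
  have kr : L k.+1 \in r.
    rewrite mem_filter mem_undup map_f ?andbT; last by rewrite mem_iota/= add0n.
    by rewrite -Lk; apply/eqP.
  rewrite (bigD1_seq (L k.+1))//= eqxx big1// => h hk.
  by rewrite eq_sym (negbTE hk).
move=> h; rewrite mem_filter => /andP[hi _].
by rewrite ifT ?inE// num_transitions_jumps// eq_sym.
Qed.

(** The run of the current state cannot reach back before the last jump, because the state just
    before it is different by [L_neq]. *)
Lemma backward_timeE t : backward_time S t = t - J (N t).
Proof.
have /andP[Jt tJ] := num_jumpsP T_gt0 t.
apply/eqP; rewrite eqn_leq; apply/andP; split.
  apply/bigmax_leqP => k /forallP Sk; rewrite leqNgt; apply/negP => kJ.
  have nk : (t - J (N t)).+1 < k.+1 by [].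
  have := Sk (Ordinal nk); rewrite /= /S /semi_markov -/(N t).
  have Jgt0 : 0 < J (N t).
    rewrite lt0n; apply/eqP => J0; move: kJ; rewrite J0 subn0.
    by rewrite ltnNge -ltnS ltn_ord.
  have [n Nn] : exists n, N t = n.+1.
    case: (N t) Jgt0 => [|n _]; first by rewrite /J jump_time0.
    by exists n.
  have -> : num_jumps T (t - (t - J (N t)).+1) = n.
    apply: num_jumps_eq => //.
    have -> : t - (t - J (N t)).+1 = (J (N t)).-1 by move: Jgt0 Jt; rewrite /J /N; lia.
    rewrite Nn /J; have := T_gt0 n; rewrite jump_timeS; lia.
  by rewrite Nn eq_sym => /eqP; exact: L_neq.
have lt : t - J (N t) < t.+1 by rewrite ltnS leq_subr.
apply: (leq_bigmax_cond (Ordinal lt)); apply/forallP => h.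
apply/eqP; congr L; apply: num_jumps_eq => //.
have := ltn_ord h; move: Jt tJ; rewrite /= /J /N; lia.
Qed.

(** Completed visits recovered from the states alone: a change between [u] and [u.+1] ends a visit,
    whose length is the backward time at [u] plus one. *)
Definition completed_visits_of_path (s : nat -> E) (i : E) (t : nat) (A : set nat) :=
  \sum_(u < t) [&& s u.+1 != s u, s u == i & (backward_time s u).+1 \in A].

Lemma num_completed_visits_path i t A :
  num_completed_visits L T i t A = completed_visits_of_path S i t A.
Proof.
rewrite /num_completed_visits /completed_visits_of_path; elim: t => [|t ih].
  rewrite big_ord0 (num_jumps_eq T_gt0 (n := 0)) ?big_ord0//.
  by rewrite jump_timeS jump_time0 add0n T_gt0.
rewrite [RHS]big_ord_recr/= -ih backward_timeE /S /semi_markov num_jumpsS// -/(N t).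
have /andP[Jt tJ] := num_jumpsP T_gt0 t.
case: (_ =P t.+1) => [eq|_]; last by rewrite addn0 eqxx addn0.
rewrite addn1 big_ord_recr/=; congr (_ + _).
rewrite andbC (_ : L (N t).+1 != L (N t)); last by apply/eqP; exact: L_neq.
congr (nat_of_bool (_ && (_ \in A))).
by move: eq Jt; rewrite jump_timeS /J -/(N t); lia.
Qed.

(** With [y] the time spent since the last jump, [y < T (N t)] is known at time [t], and the only
    value of [T (N t)] that causes a jump at [t.+1] is [y.+1]. *)
Lemma next_state_stay t y : t = J (N t) + y ->
  S t.+1 = S t <-> y.+1 < T (N t).
Proof.
move=> ty; have /andP[Jt tJ] := num_jumpsP T_gt0 t.
rewrite /S /semi_markov num_jumpsS//; move: tJ; rewrite -/(N t) jump_timeS.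
case: (_ =P t.+1) => [eq tJ|neq tJ]; rewrite -/(N t).
  rewrite addn1; split => [/L_neq//|]; move: eq ty; rewrite /J; lia.
by rewrite addn0; split => // _; move: neq ty tJ; rewrite /J; lia.
Qed.

Lemma next_state_jump t y j : t = J (N t) + y -> j != S t ->
  S t.+1 = j <-> L (N t).+1 = j /\ T (N t) = y.+1.
Proof.
move=> ty jS; have /andP[Jt tJ] := num_jumpsP T_gt0 t.
move: jS; rewrite /S /semi_markov num_jumpsS//; move: tJ; rewrite -/(N t) jump_timeS.
case: (_ =P t.+1) => [eq tJ|neq tJ] jS; rewrite -/(N t).
  rewrite addn1; split => [->|[]//]; split => //; move: eq ty; rewrite /J; lia.
rewrite addn0; split => [Lj|[_ Ty]]; first by move: jS; rewrite Lj eqxx.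
by exfalso; apply: neq; rewrite Ty; move: ty; rewrite /J; lia.
Qed.

End trajectories.

Lemma count_map_filter_iota (I : eqType) (V : Type) (p : pred V) (l : nat -> I)
    (v : nat -> V) (i : I) (n : nat) :
  count p [seq v k | k <- iota 0 n & l k == i] =
  (\sum_(k < n) (p (v k) && (l k == i)))%N.
Proof.
rewrite count_map count_filter -sum1_count big_mkcond/=.
rewrite -(big_mkord xpredT (fun k => (p (v k) && (l k == i) : nat))) /index_iota subn0.
by apply: eq_bigr => k _; case: (_ && _).
Qed.

(** * Urn quotients for path probabilities *)

Section path_probabilities.
Context d (O : measurableType d) (R : realType) (Pr : probability O R).
Context dE (E : measurableType dE).
Hypothesis E_countable : countable [set: E].
Hypothesis E_discrete : forall A : set E, measurable A.
Variables (m : E -> {measure set E -> \bar R}) (c : E -> nat -> R)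
  (F0 : E -> probability nat R).
Hypothesis m_finite : forall i, (0 < m i [set: E] < +oo)%E.
Hypothesis c_gt0 : forall i t, (0 < t)%N -> 0 < c i t.
Hypothesis F0_tail_gt0 : forall i t, (0 < F0 i [set s | (t < s)%N])%E.
Variables (P : E -> R.-pker O ~> E) (F : E -> R.-pker O ~> nat).
Hypothesis PF_smbs : smbs Pr P F m c F0.
Variables (l : nat -> E) (tau : nat -> nat) (n : nat).
Hypothesis tau_gt0 : forall k, (0 < tau k)%N.

Let i := l n.
Let lengths := [seq tau k | k <- iota 0 n & l k == i].
Let successors := [seq l k.+1 | k <- iota 0 n & l k == i].

Let expF (A : set nat) := (\int[Pr]_w
  (fine (F i w A) * \prod_(k < n) fine (F (l k) w [set tau k]))%:E)%E.
Let expP (A : set E) := (\int[Pr]_w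
  (fine (P i w A) * \prod_(k < n) fine (P (l k) w [set l k.+1]))%:E)%E.

Let row d' (V : measurableType d') (v : nat -> V) (f : R.-pker O ~> V) w :
  \prod_(x <- [seq (l k, [set v k]) | k <- iota 0 n] | x.1 == i) fine (f w x.2) =
  \prod_(s <- [seq v k | k <- iota 0 n & l k == i]) fine (f w [set s]).
Proof. by rewrite !big_map big_filter. Qed.

Let all_rows d' (V : measurableType d') (v : nat -> V) (f : E -> R.-pker O ~> V) w :
  \prod_(k < n) fine (f (l k) w [set v k]) =
  \prod_(x <- [seq (l k, [set v k]) | k <- iota 0 n]) fine (f x.1 w x.2).
Proof.
by rewrite big_map -(big_mkord xpredT (fun k => fine (f (l k) w [set v k]))) /index_iota subn0.
Qed.

Let denF y := c i y.+1 * fine (F0 i [set s | (y.+1 <= s)%N]) +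
  (count (leq y.+1) lengths)%:R.

(** The rows other than [i] contribute one factor [C] to all expectations, which leaves the
    beta-Stacy identities for [F i]; the two beta parameters add up to the prior part of
    [denF y]. *)
Lemma path_length_urn y :
  ((denF y)%:E * expF [set y.+1] =
     (c i y.+1 * fine (F0 i [set y.+1]) + (count_mem y.+1 lengths)%:R)%:E *
     expF [set s | (y < s)%N])%E /\
  ((denF y)%:E * expF [set s | (y.+1 < s)%N] =
     (c i y.+1 * fine (F0 i [set s | (y.+1 < s)%N]) + (count (leq y.+2) lengths)%:R)%:E *
     expF [set s | (y < s)%N])%E.
Proof.
have [couple _ [_ indF] _ bs] := PF_smbs.
have [U [indU lawU fU]] := bs i.
pose z := [seq (l k, [set tau k]) | k <- iota 0 n].
have [C split_rows] := @expectation_row_split _ O R Pr _ _ _ F indF z i (fun _ _ => I).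
have expFE A : (expF A = C * \int[Pr]_w
    (fine (F i w A) * \prod_(s <- lengths) fine (F i w [set s]))%:E)%E.
  rewrite /expF; under eq_integral do rewrite all_rows.
  by rewrite split_rows//; under eq_integral do rewrite row.
pose a t := c i t.+1 * fine (F0 i [set t.+1]).
pose b t := c i t.+1 * fine (F0 i [set s | (t.+1 < s)%N]).
have a0 t : 0 <= a t by rewrite mulr_ge0 ?fine_ge0// ltW// c_gt0.
have b0 t : 0 < b t.
  rewrite mulr_gt0 ?c_gt0// fine_gt0// F0_tail_gt0/=.
  by rewrite (le_lt_trans (probability_le1 _ _))// ltry.
have lawab t : has_law (U t.+1) (beta_law (a t) (b t)) by exact: lawU.
have abE : a y + b y = c i y.+1 * fine (F0 i [set s | (y.+1 <= s)%N]).
  rewrite -mulrDr; congr (_ * _); rewrite -fine_tailS//.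
  exact: (le_lt_trans (probability_le1 (F0 i) measurableT) (ltry 1)).
have lengths_gt0 : all (leq 1) lengths by apply/allP => s /mapP[k _ ->]; exact: tau_gt0.
have [eqx eqs] := beta_stacy_path_urn a0 b0 indU lawab
  (fun w => (couple w i).2) fU y lengths_gt0.
by rewrite !expFE /denF -abE !(muleCA _ C) eqx eqs.
Qed.

Lemma path_successor_urn j :
  ((fine (m i [set: E]) + (size successors)%:R)%:E * expP [set j] =
   (fine (m i [set j]) + (count_mem j successors)%:R)%:E *
     \int[Pr]_w (\prod_(k < n) fine (P (l k) w [set l k.+1]))%:E)%E.
Proof.
have [_ _ [indP _] dir _] := PF_smbs.
pose z := [seq (l k, [set l k.+1]) | k <- iota 0 n].
have [C split_rows] := @expectation_row_split _ O R Pr _ _ _ P indP z i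
  (fun _ _ => E_discrete _).
have expPE A : (expP A = C * \int[Pr]_w
    (fine (P i w A) * \prod_(s <- successors) fine (P i w [set s]))%:E)%E.
  rewrite /expP; under eq_integral do rewrite (all_rows (fun k => l k.+1)).
  by rewrite split_rows//; under eq_integral do rewrite (row (fun k => l k.+1)).
have PT w : fine (P i w [set: E]) = 1.
  by transitivity (fine (1%E : \bar R)) => //; congr fine; exact: prob_kernel.
(* The set [setT] has mass [1] in every row, so this instance shows that the moment without an
   additional factor carries the same [C]. *)
have := expPE setT; rewrite /expP.
under eq_integral do rewrite PT mul1r.
under [X in (_ = C * X)%E -> _]eq_integral do rewrite PT mul1r.
move=> ->; rewrite -/(expP [set j]) expPE muleCA [RHS]muleCA; congr (_ * _)%E.
exact: (dirichlet_process_urn E_discrete (m_finite i) (dir i)).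
Qed.

Variables (L : nat -> {RV Pr >-> E}) (T : nat -> {RV Pr >-> nat}).
Hypothesis LT_renewal : markov_renewal (l 0%N) P F L T.

Let couple_measurableF (A : set nat) : measurable_fun
  [set: g_sigma_algebraType (\bigcup_i random_measure_events (F i))]
  (fun w => (fine (F i w A) * \prod_(k < n) fine (F (l k) w [set tau k]))%:E).
Proof.
have mF h B : measurable_fun
    [set: g_sigma_algebraType (\bigcup_i random_measure_events (F i))]
    (fun w : g_sigma_algebraType _ => fine (F h w B)).
  by apply: measurable_fine_kernel => // C FC; apply: sub_sigma_algebra; exists h.
by apply/measurable_EFinP/measurable_funM => //; apply: measurable_prod.
Qed.

Let couple_measurableP (A : set E) : measurable_fun
  [set: g_sigma_algebraType (\bigcup_i random_measure_events (P i))]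
  (fun w => (fine (P i w A) * \prod_(k < n) fine (P (l k) w [set l k.+1]))%:E).
Proof.
have mP h B : measurable_fun
    [set: g_sigma_algebraType (\bigcup_i random_measure_events (P i))]
    (fun w : g_sigma_algebraType _ => fine (P h w B)).
  by apply: measurable_fine_kernel => // C PC; apply: sub_sigma_algebra; exists h.
by apply/measurable_EFinP/measurable_funM => //; apply: measurable_prod.
Qed.

Let expFP (A : set nat) (B : set E) :
  (\int[Pr]_w ((fine (F i w A) * \prod_(k < n) fine (F (l k) w [set tau k]))
      * (fine (P i w B) * \prod_(k < n) fine (P (l k) w [set l k.+1])))%:E =
   expF A * expP B)%E.
Proof.
have [_ indPF _ _ _] := PF_smbs.
have mGP : \bigcup_i random_measure_events (P i) `<=` measurable.
  by move=> C [h _]; exact: random_measure_events_measurable.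
have mGF : \bigcup_i random_measure_events (F i) `<=` measurable.
  by move=> C [h _]; exact: random_measure_events_measurable.
rewrite muleC -(expectation_mul mGP mGF indPF (@couple_measurableP B) (@couple_measurableF A)).
- by apply: eq_integral => w _; rewrite -EFinM mulrC.
- by move=> w; rewrite lee_fin mulr_ge0 ?fine_ge0// prodr_ge0// => k _; rewrite fine_ge0.
- by move=> w; rewrite lee_fin mulr_ge0 ?fine_ge0// prodr_ge0// => k _; rewrite fine_ge0.
Qed.

Let path := path_event L T l tau n.

Let mul_ratio (D a : R) (x z : \bar R) : D != 0 ->
  (D%:E * x = a%:E * z -> x = (a / D)%:E * z)%E.
Proof.
move=> D0 /(congr1 (fun u => D^-1%:E * u)%E).
by rewrite !muleA -!EFinM mulVf// mul1e mulrC.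
Qed.

Let expPT : (expP setT = \int[Pr]_w (\prod_(k < n) fine (P (l k) w [set l k.+1]))%:E)%E.
Proof.
apply: eq_integral => w _; congr EFin; rewrite -[RHS]mul1r; congr (_ * _).
by transitivity (fine (1%E : \bar R)) => //; congr fine; exact: prob_kernel.
Qed.

Let denF_neq0 y : denF y != 0.
Proof.
rewrite gt_eqF// ltr_wpDr// mulr_gt0 ?c_gt0// fine_gt0// F0_tail_gt0/=.
by rewrite (le_lt_trans (probability_le1 _ _))// ltry.
Qed.

Let path_stay y : (Pr (path `&` [set w | (y < T n w)%N]) =
  expF [set s | (y < s)%N] * expP setT)%E.
Proof.
have [couple _ _ _ _] := PF_smbs; have [T_gt0 L0 LT] := LT_renewal.
rewrite /path (path_event_stay E_countable E_discrete couple T_gt0 LT _ L0) -expFP.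
apply: eq_integral => w _; congr EFin; congr (_ * _).
rewrite -[LHS]mul1r; congr (_ * _).
by transitivity (fine (1%E : \bar R)) => //; congr fine; exact/esym/prob_kernel.
Qed.

(** A product and not a quotient of probabilities, as the conditioning event may be null; only the
    positive [denF y] is divided by. *)
Lemma path_predictive_stay y :
  (Pr (path `&` [set w | (y.+1 < T n w)%N]) =
   ((c i y.+1 * fine (F0 i [set s | (y.+1 < s)%N]) + (count (leq y.+2) lengths)%:R)
     / denF y)%:E * Pr (path `&` [set w | (y < T n w)%N]))%E.
Proof.
rewrite !path_stay muleA; congr (_ * _)%E; apply: mul_ratio => //.
by have [_ ->] := path_length_urn y.
Qed.

Lemma path_predictive_jump y j :
  (Pr (path `&` [set w | L n.+1 w = j /\ T n w = y.+1]) =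
   ((c i y.+1 * fine (F0 i [set y.+1]) + (count_mem y.+1 lengths)%:R) / denF y *
    ((fine (m i [set j]) + (count_mem j successors)%:R) /
     (fine (m i [set: E]) + (size successors)%:R)))%:E
   * Pr (path `&` [set w | (y < T n w)%N]))%E.
Proof.
have [couple _ _ _ _] := PF_smbs; have [T_gt0 L0 LT] := LT_renewal.
rewrite path_stay /path.
rewrite (path_event_jump E_discrete couple T_gt0 LT _ L0) expFP EFinM muleACA.
congr (_ * _)%E; apply: mul_ratio => //.
- by have [-> _] := path_length_urn y.
- rewrite gt_eqF// ltr_wpDr// fine_gt0//; exact: m_finite.
- by rewrite expPT path_successor_urn.
Qed.

End path_probabilities.

(** The level sets of [f] form a countable partition into measurable sets, and a saturated [D] is a
    union of some of them. *)
Lemma measurable_saturated d (V : measurableType d) (f : V -> nat) (D : set V) :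
  (forall x, measurable [set y | f y = f x]) ->
  (forall x y, f x = f y -> D x -> D y) -> measurable D.
Proof.
move=> mf fD; rewrite (_ : D = \bigcup_k (D `&` [set y | f y = k])); last first.
  by apply/seteqP; split => [y Dy|y [k _ []//]]; exists (f y).
apply: bigcupT_measurable => k.
have [[x [Dx fx]]|nx] := pselect (exists x, D x /\ f x = k).
  rewrite (_ : _ `&` _ = [set y | f y = f x])//.
  apply/seteqP; split => y /=; first by move=> [_ ->].
  by move=> yx; split; [exact: fD Dx|rewrite yx].
rewrite (_ : _ `&` _ = set0)//.
by apply/seteqP; split => // y [Dy yk]; apply: nx; exists y.
Qed.

Lemma measure_ae_eq d (V : measurableType d) (R : realType)
    (mu : {measure set V -> \bar R}) (A B : set V) :
  measurable A -> measurable B -> {ae mu, forall x, A x <-> B x} -> mu A = mu B.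
Proof.
move=> mA mB AB; rewrite -(setIT A) -(setIT B) -!integral_indic//.
apply: ge0_ae_eq_integral => //.
- exact/measurable_EFinP/measurable_indic.
- exact/measurable_EFinP/measurable_indic.
by apply: filterS AB => x ABx _; rewrite !indicE (_ : (x \in A) = (x \in B))//;
  apply/idP/idP; rewrite !inE => /ABx.
Qed.

(** * The sigma-algebra of a path with countably many values *)

Section path_sigma_algebra.
Context d (O : measurableType d) dE (E : measurableType dE).
Hypothesis E_countable : countable [set: E].
Hypothesis E_discrete : forall A : set E, measurable A.
Variables (X : nat -> O -> E) (t : nat).
Let Xevents := \bigcup_(k in [set k | (k <= t)%N]) events (X k).

(** The sets that do not separate [w] from [w'] form a sigma-algebra containing the generators. *)
Lemma path_sigma_saturated (B : set O) w w' : <<s Xevents >> B ->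
  (forall u, (u <= t)%N -> X u w = X u w') -> B w -> B w'.
Proof.
move=> sB ww'.
suff : B w <-> B w' by case.
pose C := [set D : set O | D w <-> D w'].
apply: (@smallest_sub _ (sigma_algebra setT) Xevents C _ _ B sB).
  split => [|D|D CD]; rewrite /C/=.
  - by [].
  - by move=> [h1 h2]; split => -[_ nD]; split => // Dw; apply: nD; [exact: h2|exact: h1].
  - by split => -[k _ Dk]; exists k => //; apply/(CD k).
by move=> D [k kt [A mA <-]]; rewrite /C setTI /= ww'.
Qed.

(** Converse of [path_sigma_saturated], valid because a path up to [t] has an integer code whose
    level sets are finite intersections of generators. *)
Lemma saturated_path_sigma (B : set O) :
  (forall w w', (forall u, (u <= t)%N -> X u w = X u w') -> B w -> B w') ->
  <<s Xevents >> B.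
Proof.
move=> sB; have [e einj] := countable_injP _ E_countable.
pose f w := @choice.pickle (seq nat) [seq e (X u w) | u <- iota 0 t.+1].
have fE w w' : f w = f w' <-> forall u, (u <= t)%N -> X u w = X u w'.
  split => [/(pcan_inj choice.pickleK)/eq_in_map h u ut|h].
    by apply: einj; rewrite ?inE//; apply: h; rewrite mem_iota.
  congr (choice.pickle _); apply/eq_in_map => u; rewrite mem_iota add0n ltnS => ut.
  by rewrite h.
apply: (@measurable_saturated _ (g_sigma_algebraType Xevents) f); last first.
  by move=> w w' /fE; exact: sB.
move=> w; rewrite (_ : [set y | _] = \bigcap_(u in `I_t.+1) (X u @^-1` [set X u w])).
  apply: fin_bigcap_measurable; first exact: finite_II.
  move=> u /= ut; apply: sub_sigma_algebra; exists u => //.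
  by exists [set X u w] => //; rewrite setTI.
by apply/seteqP; split => y /= => [/fE h u ut|h]; [exact: h|apply/fE => u ut; exact: h].
Qed.

End path_sigma_algebra.

(** * The predictive kernel as a function of the path *)

Section predictive_of_path.
Context {dE} {E : measurableType dE} {R : realType}.
Variables (m : E -> {measure set E -> \bar R}) (c : E -> nat -> R)
  (F0 : E -> probability nat R).

(* Same formula as [smbs_predictive], with the completed visits read off the
   path of states itself: this makes it a function of [S_{0:t}], and the two
   agree as soon as consecutive renewal states differ. *)
Definition path_predictive (s : nat -> E) (t : nat) (j : E) : R :=
  let i := s t in
  let x := (backward_time s t).+1 in
  let F0i A : R := fine (F0 i A) in
  let N A : R := (completed_visits_of_path s i t A)%:R in
  let M h := num_transitions s i h t in
  let den := c i x * F0i [set u | (x <= u)%N] + N [set u | (x <= u)%N] in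
  if j == i then
    (c i x * F0i [set u | (x < u)%N] + N [set u | (x < u)%N]) / den
  else
    (c i x * F0i [set x] + N [set x]) / den
    * ((fine (m i [set j]) + (M j)%:R)
       / (fine (m i [set: E])
          + (\big[addn/0%N]_(h \in [set h | h != i]) M h)%:R)).

Lemma eq_path_predictive (s s' : nat -> E) t j :
  (forall u, (u <= t)%N -> s u = s' u) ->
  path_predictive s t j = path_predictive s' t j.
Proof.
move=> ss'.
have bE u : (u <= t)%N -> backward_time s u = backward_time s' u.
  move=> ut; apply: eq_bigl => k; apply: eq_forallb => h.
  by rewrite !ss'// (leq_trans (leq_subr _ _)).
have NE i A : completed_visits_of_path s i t A = completed_visits_of_path s' i t A.
  by apply: eq_bigr => u _; rewrite !ss' ?bE// ltnW.
have ME i h : num_transitions s i h t = num_transitions s' i h t.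
  rewrite /num_transitions big_nat [RHS]big_nat; apply: eq_bigr => k /andP[_ kt].
  by rewrite !ss'// (leq_trans (leq_pred k)).
rewrite /path_predictive ss'// bE// !NE ME.
by under eq_fsbigr do rewrite ME.
Qed.

Hypothesis c_gt0 : forall i t, (0 < t)%N -> 0 < c i t.

Lemma path_predictive_ge0 s t j : 0 <= path_predictive s t j.
Proof.
have cge0 i t' : 0 <= c i t'.+1 by rewrite ltW// c_gt0.
rewrite /path_predictive; case: ifP => _.
  by rewrite divr_ge0// addr_ge0// mulr_ge0// fine_ge0.
by rewrite mulr_ge0// divr_ge0// addr_ge0// ?mulr_ge0// fine_ge0.
Qed.

Lemma smbs_predictiveE (L : nat -> E) (T : nat -> nat) t j :
  (forall k, (0 < T k)%N) -> (forall k, L k.+1 <> L k) ->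
  smbs_predictive m c F0 L T t j = path_predictive (semi_markov L T) t j.
Proof.
move=> T_gt0 L_neq; rewrite /smbs_predictive /path_predictive.
by rewrite !(num_completed_visits_path T_gt0 L_neq).
Qed.

(** Brings the kernel to the counts over the lists [lengths] and [successors] in which the urn
    identities are phrased. *)
Lemma smbs_predictive_visits (L : nat -> E) (T : nat -> nat) t j :
  (forall k, (0 < T k)%N) -> (forall k, L k.+1 <> L k) ->
  let n := num_jumps T t in let i := L n in
  let y := (t - jump_time T n)%N in
  let lengths := [seq T k | k <- iota 0 n & L k == i] in
  let successors := [seq L k.+1 | k <- iota 0 n & L k == i] in
  let den := c i y.+1 * fine (F0 i [set s | (y.+1 <= s)%N]) +
    (count (leq y.+1) lengths)%:R in
  smbs_predictive m c F0 L T t j =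
  if j == i then
    (c i y.+1 * fine (F0 i [set s | (y.+1 < s)%N]) + (count (leq y.+2) lengths)%:R) / den
  else
    (c i y.+1 * fine (F0 i [set y.+1]) + (count_mem y.+1 lengths)%:R) / den *
    ((fine (m i [set j]) + (count_mem j successors)%:R) /
     (fine (m i [set: E]) + (size successors)%:R)).
Proof.
move=> T_gt0 L_neq n i y lengths successors den.
have NE (A : set nat) (p : pred nat) : (forall s, A s <-> p s) ->
    num_completed_visits L T i t A = count p lengths.
  move=> Ap; rewrite /lengths count_map_filter_iota /num_completed_visits.
  apply: eq_bigr => k _; congr (nat_of_bool (_ && _)).
  by apply/idP/idP; rewrite inE => /Ap.
rewrite /smbs_predictive -[semi_markov L T t]/i (backward_timeE T_gt0 L_neq) -/n -/y.
rewrite (NE [set s | (y.+1 <= s)%N] (leq y.+1))//.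
rewrite (NE [set s | (y.+1 < s)%N] (leq y.+2))//.
rewrite (NE [set y.+1] (pred1 y.+1)); last by move=> s; split => [->|/eqP//] /=.
rewrite (sum_num_transitions T_gt0 L_neq).
have [//|ji] := eqVneq j i.
rewrite num_transitions_jumps 1?eq_sym//.
congr (_ * ((_ + _%:R) / (_ + _%:R))).
  rewrite /successors (count_map_filter_iota (pred1 j)).
  by apply: eq_bigr => k _; rewrite /= andbC.
rewrite -(count_predT successors) /successors count_map_filter_iota.
by apply: eq_bigr => k _.
Qed.

End predictive_of_path.

(** * Renewal cells and their predictive probabilities *)

Section renewal_atoms.
Context d (O : measurableType d) (R : realType) (Pr : probability O R).
Context dE (E : measurableType dE).
Variables (L : nat -> {RV Pr >-> E}) (T : nat -> {RV Pr >-> nat}).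
Hypothesis T_gt0 : forall n w, (0 < T n w)%N.
Let S t w := semi_markov (fun k => L k w) (fun k => T k w) t.
Let N t w := num_jumps (fun k => T k w) t.
Let J n w := jump_time (fun k => T k w) n.

(** Described by renewal data, so that it is a path event with a bound on the current holding time.
    Among trajectories without self-jumps, and for such a [w0], it consists of those with the same
    states as [w0] up to [t]. *)
Definition renewal_atom (t : nat) (w0 : O) : set O :=
  path_event L T (fun k => L k w0) (fun k => T k w0) (N t w0) `&`
  [set w | (t - J (N t w0) w0 < T (N t w0) w)%N].

Lemma renewal_atomP t w0 w : renewal_atom t w0 w <->
  [/\ N t w = N t w0, forall k, (k <= N t w0)%N -> L k w = L k w0
    & forall k, (k < N t w0)%N -> T k w = T k w0].
Proof.
have /andP[Jt tJ] := num_jumpsP (T_gt0^~ w0) t; rewrite -/(N t w0) -/(J _ w0) in Jt tJ.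
have JE : (forall k, (k < N t w0)%N -> T k w = T k w0) -> J (N t w0) w = J (N t w0) w0.
  by move=> Tw; apply: eq_bigr => k _; exact: Tw.
split=> [[[Lw Tw] /= yT]|[Nw Lw Tw]].
  split=> //; apply: num_jumps_eq => //; move: (JE Tw); rewrite jump_timeS /J => ->.
  by move: Jt yT; rewrite /J; lia.
split=> //=; have := num_jumpsP (T_gt0^~ w) t; rewrite jump_timeS -/(N t w) Nw.
by move: (JE Tw); rewrite /J => ->; lia.
Qed.

Lemma renewal_atom_path t u w0 w : (u <= t)%N -> renewal_atom t w0 w -> S u w = S u w0.
Proof.
move=> ut /renewal_atomP[Nw Lw Tw].
have /andP[Ju uJ] := num_jumpsP (T_gt0^~ w0) u.
have /andP[Jt tJ] := num_jumpsP (T_gt0^~ w0) t.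
have /andP[Jt' tJ'] := num_jumpsP (T_gt0^~ w) t.
have JE k : (k <= N t w0)%N -> J k w = J k w0.
  by move=> kN; apply: eq_bigr => h _; apply: Tw; rewrite (leq_trans (ltn_ord h)).
have uN : (N u w0 <= N t w0)%N.
  rewrite -ltnS -[(_ < _)%N]negbK -leqNgt -(jump_time_mono (T_gt0^~ w0)) -ltnNge.
  by rewrite (leq_ltn_trans Ju)// (leq_ltn_trans ut).
suff NE : N u w = N u w0 by rewrite /S /semi_markov -/(N u w) -/(N u w0) NE Lw.
apply: num_jumps_eq => //; rewrite -/(J _ w) JE// Ju/=.
move: uN; rewrite leq_eqVlt => /predU1P[->|uN]; last by rewrite -/(J _ w) JE.
by rewrite -Nw (leq_ltn_trans ut).
Qed.

Hypothesis E_countable : countable [set: E].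

(** The finitely many data that fix a cell are encoded as one integer; hence the cells are the
    classes of an equivalence with countably many classes. *)
Lemma renewal_atom_code t :
  exists f : O -> nat, forall w w0, f w = f w0 <-> renewal_atom t w0 w.
Proof.
have [e einj] := countable_injP _ E_countable.
pose f w := @choice.pickle (seq nat * seq nat)%type
  ([seq e (L k w) | k <- iota 0 (N t w).+1], [seq T k w | k <- iota 0 (N t w)]).
exists f => w w0; split => [/(pcan_inj choice.pickleK)/pair_equal_spec[eL eT]|/renewal_atomP[Nw Lw Tw]].
  have Nw : N t w = N t w0.
    by have := congr1 size eT; rewrite !size_map !size_iota.
  apply/renewal_atomP; split => // k kN.
  - apply: einj; rewrite ?inE//; move: k kN.
    have /eq_in_map h : [seq e (L k w) | k <- iota 0 (N t w).+1] =
      [seq e (L k w0) | k <- iota 0 (N t w).+1] by rewrite eL Nw.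
    by move=> k kN; apply: h; rewrite mem_iota Nw.
  - have /eq_in_map h : [seq T k w | k <- iota 0 (N t w)] =
      [seq T k w0 | k <- iota 0 (N t w)] by rewrite eT Nw.
    by apply: h; rewrite mem_iota Nw.
rewrite /f Nw; congr (choice.pickle (_, _)); apply/eq_in_map => k;
  rewrite mem_iota add0n => kN; first by rewrite Lw.
exact: Tw.
Qed.

Hypothesis E_discrete : forall A : set E, measurable A.

Lemma measurable_renewal_atom t w : measurable (renewal_atom t w).
Proof.
apply: measurableI; first exact: measurable_path_event.
rewrite (_ : [set _ | _] = T (N t w) @^-1` [set s | (t - J (N t w) w < s)%N])//.
by rewrite -[X in measurable X]setTI; exact: measurable_funPT.
Qed.

Lemma measurable_semi_markov t j : measurable [set w | S t w = j].
Proof.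
have [f fE] := renewal_atom_code t.
apply: (@measurable_saturated _ _ f) => [w|w w' /fE/(renewal_atom_path (leqnn t)) ww' <-//].
rewrite (_ : [set y | _] = renewal_atom t w); first exact: measurable_renewal_atom.
by apply/seteqP; split => y /fE.
Qed.

End renewal_atoms.

Section renewal_atom_predictive.
Context d (O : measurableType d) (R : realType) (Pr : probability O R).
Context dE (E : measurableType dE).
Hypothesis E_countable : countable [set: E].
Hypothesis E_discrete : forall A : set E, measurable A.
Variables (l0 : E) (m : E -> {measure set E -> \bar R}) (c : E -> nat -> R)
  (F0 : E -> probability nat R).
Hypothesis m_finite : forall i, (0 < m i [set: E] < +oo)%E.
Hypothesis c_gt0 : forall i t, (0 < t)%N -> 0 < c i t.
Hypothesis F0_tail_gt0 : forall i t, (0 < F0 i [set s | (t < s)%N])%E.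
Variables (P : E -> R.-pker O ~> E) (F : E -> R.-pker O ~> nat).
Hypothesis PF_smbs : smbs Pr P F m c F0.
Variables (L : nat -> {RV Pr >-> E}) (T : nat -> {RV Pr >-> nat}).
Hypothesis LT_renewal : markov_renewal l0 P F L T.
Let S t w := semi_markov (fun k => L k w) (fun k => T k w) t.

Lemma renewal_atom_predictive t j w0 :
  L 0%N w0 = l0 -> (forall k, L k.+1 w0 <> L k w0) ->
  (Pr ([set w | S t.+1 w = j] `&` renewal_atom L T t w0) =
   (smbs_predictive m c F0 (fun k => L k w0) (fun k => T k w0) t j)%:E *
     Pr (renewal_atom L T t w0))%E.
Proof.
move=> L0 L_neq; have [couple _ _ _ _] := PF_smbs; have [T_gt0 _ _] := LT_renewal.
have ae_neq := consecutive_states_neq E_countable E_discrete couple LT_renewal.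
have LT : markov_renewal (L 0%N w0) P F L T by rewrite L0.
have mS := measurable_semi_markov L T_gt0 E_countable E_discrete t.+1 j.
have mK := measurable_renewal_atom L T E_discrete t w0.
rewrite (smbs_predictive_visits m c F0 t j (T_gt0^~ w0) L_neq)/=.
set n := num_jumps _ t; set y := (t - _)%N.
pose path := path_event L T (fun k => L k w0) (fun k => T k w0) n.
have mpath : measurable path by exact: measurable_path_event.
have KE w : renewal_atom L T t w0 w -> S t w = L n w0 /\
    num_jumps (fun k => T k w) t = n /\ t = (jump_time (fun k => T k w) n + y)%N.
  move=> Kw; have := renewal_atom_path T_gt0 (leqnn t) Kw.
  rewrite /S /semi_markov; split => //; case/(renewal_atomP L T_gt0): Kw => Nw _ Tw.
  split=> //; rewrite (_ : jump_time _ n = jump_time (fun k => T k w0) n).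
    by rewrite subnKC//; case/andP: (num_jumpsP (T_gt0^~ w0) t).
  by apply: eq_bigr => k _; exact: Tw.
case: ifPn => [/eqP jE|jn].
- rewrite -(path_predictive_stay E_countable E_discrete c_gt0 F0_tail_gt0 PF_smbs
    n (T_gt0^~ w0) LT y).
  (* Equality holds only almost surely: a self-jump would keep the state unchanged although the
     holding time equals [y.+1]. *)
  apply: measure_ae_eq.
  + exact: measurableI.
  + apply: measurableI => //; rewrite -[X in measurable X]setTI.
    by rewrite (_ : [set w | _] = T n @^-1` [set s | (y.+1 < s)%N])//; exact: measurable_funPT.
  apply: filterS ae_neq => w w_neq.
  have stayE : renewal_atom L T t w0 w -> S t.+1 w = j <-> (y.+1 < T n w)%N.
    move=> /KE[Stw [<- tE]]; rewrite jE -Stw.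
    exact: (next_state_stay (T_gt0^~ w) w_neq tE).
  split=> [[/= Sw Kw]|[pw /= yT]]; first by split; [case: Kw|exact/stayE].
  have Kw : renewal_atom L T t w0 w by split => //=; exact: ltnW.
  by split => //; exact/stayE.
rewrite -(path_predictive_jump E_countable E_discrete m_finite c_gt0 F0_tail_gt0 PF_smbs
  n (T_gt0^~ w0) LT y).
have jumpE w : renewal_atom L T t w0 w ->
    S t.+1 w = j <-> L n.+1 w = j /\ T n w = y.+1.
  move=> /KE[Stw [<- tE]]; have jS : j != S t w by rewrite Stw.
  exact: (next_state_jump (T_gt0^~ w) tE jS).
(* Here the events coincide everywhere, since a different state can only be reached by a jump. *)
congr (Pr _); apply/seteqP; split => [w [/= Sw Kw]|w [pw /= LTw]].
  by split; [case: Kw|exact/jumpE].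
have Kw : renewal_atom L T t w0 w by split => //=; rewrite LTw.2.
by split => //; exact/jumpE.
Qed.

End renewal_atom_predictive.

Theorem theorem5p1 (R : realType)
  (d : measure_display) (O : measurableType d) (Pr : probability O R)
  (dE : measure_display) (E : measurableType dE)
  (E_countable : countable [set: E])
  (E_discrete : forall A : set E, measurable A)
  (l0 : E)
  (m : E -> {measure set E -> \bar R})
  (m_finite : forall i, (0 < m i [set: E] < +oo)%E)
  (m_diag : forall i, m i [set i] = 0%E)
  (c : E -> nat -> R)
  (c_gt0 : forall i t, (0 < t)%N -> 0 < c i t)
  (F0 : E -> probability nat R)
  (F0_pos_integers : forall i, F0 i [set 0%N] = 0%E)
  (F0_tail_gt0 : forall i t, (0 < F0 i [set s | (t < s)%N])%E)
  (P : E -> R.-pker O ~> E) (F : E -> R.-pker O ~> nat)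
  (PF_smbs : smbs Pr P F m c F0)
  (L : nat -> {RV Pr >-> E}) (T : nat -> {RV Pr >-> nat})
  (LT_renewal : markov_renewal l0 P F L T) :
  let S (t : nat) (w : O) : E := semi_markov (fun n => L n w) (fun n => T n w) t in
  forall (t : nat) (j : E),
    cond_prob_eq Pr
      <<s \bigcup_(k in [set k | (k <= t)%N]) events (S k) >>
      [set w | S t.+1 w = j]
      (fun w => smbs_predictive m c F0 (fun n => L n w) (fun n => T n w) t j).
Proof.
move=> S t j; have [couple _ _ _ _] := PF_smbs; have [T_gt0 L0 _] := LT_renewal.
have ae_neq := consecutive_states_neq E_countable E_discrete couple LT_renewal.
pose good w := L 0%N w = l0 /\ forall k, L k.+1 w <> L k w.
have ae_good : {ae Pr, forall w, good w} by apply: filterS2 L0 ae_neq => w; split.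
pose g w := path_predictive m c F0 (fun u => S u w) t j.
have g_ge0 w : 0 <= g w by exact: path_predictive_ge0.
have gE w w' : (forall u, (u <= t)%N -> S u w = S u w') -> g w = g w'.
  by move=> ww'; exact: eq_path_predictive.
have [code codeE] := renewal_atom_code L T_gt0 E_countable t.
have mK w := measurable_renewal_atom L T E_discrete t w.
have levelE w : [set y | code y = code w] = renewal_atom L T t w.
  by apply/seteqP; split => y /codeE.
have mcode k : measurable [set w | code w = k].
  have [[w <-]|nk] := pselect (exists w, code w = k); first by rewrite levelE.
  by rewrite (_ : [set _ | _] = set0)//; apply/seteqP; split => // w ?; apply: nk; exists w.
have mS u : measurable [set w | S u w = j].
  exact: measurable_semi_markov.
have msat (D : set O) : (forall w w', (forall u, (u <= t)%N -> S u w = S u w') -> D w -> D w') ->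
    measurable D.
  move=> sD; apply: (@measurable_saturated _ _ code) => [w|w w' /codeE ww'].
    exact: mcode.
  by apply: sD => u ut; exact: (renewal_atom_path T_gt0 ut).
have mg : measurable_fun setT g.
  move=> _ B mB; rewrite setTI; apply: msat => w w' ww'.
  by rewrite /preimage/= (gE _ _ ww').
have mgB (B : set O) : measurable_fun B (EFin \o g).
  exact/measurable_funTS/measurable_EFinP.
have level k (B : set O) :
    (forall w w', (forall u, (u <= t)%N -> S u w = S u w') -> B w -> B w') ->
    (\int[Pr]_(w in B `&` [set w | code w = k]) (g w)%:E =
      Pr ([set w | S t.+1 w = j] `&` (B `&` [set w | code w = k])))%E.
  move=> sB; have mB := msat B sB.
  have mBk : measurable (B `&` [set w | code w = k]) by exact: measurableI.
  (* The formula for a cell requires a representative that starts at [l0] and has no self-jump. If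
     [B] meets the cell in no such point, the intersection is null and both sides vanish. *)
  have [[w0 [[Bw0 kw0] [L0w neqw]]]|nk] :=
      pselect (exists w, (B `&` [set w | code w = k]) w /\ good w); last first.
    have Bk0 : Pr (B `&` [set w | code w = k]) = 0%E.
      rewrite -(measure0 Pr); apply: measure_ae_eq => //.
      by apply: filterS ae_good => w gw; split => // Bkw; apply: nk; exists w.
    rewrite null_set_integral//; apply/esym/(subset_measure0 _ mBk _ Bk0) => //.
    exact: measurableI.
  (* The path up to [t] is constant on a cell, so a saturated [B] that meets the cell contains
     it. *)
  have -> : B `&` [set w | code w = k] = renewal_atom L T t w0.
    rewrite -levelE -kw0; apply/seteqP; split => [w []//|w /= ww0]; split => //.
    apply: sB Bw0 => u ut; apply/esym/(renewal_atom_path T_gt0 ut).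
    exact/codeE.
  rewrite (renewal_atom_predictive E_countable E_discrete m_finite c_gt0 F0_tail_gt0
    PF_smbs LT_renewal)//.
  rewrite (smbs_predictiveE m c F0 t j (T_gt0^~ w0) neqw) -/(g w0).
  rewrite -integral_cst//; apply: eq_integral => w; rewrite inE => Kw.
  by congr EFin; apply: gE => u ut; exact: (renewal_atom_path T_gt0 ut).
have integral_g (B : set O) :
    (forall w w', (forall u, (u <= t)%N -> S u w = S u w') -> B w -> B w') ->
    (\int[Pr]_(w in B) (g w)%:E = Pr ([set w | S t.+1 w = j] `&` B))%E.
  move=> sB; have mB := msat B sB.
  have BE : B = \bigcup_k (B `&` [set w | code w = k]).
    by apply/seteqP; split => [w Bw|w [k _ []//]]; exists (code w).
  have tB : trivIset setT (fun k => B `&` [set w | code w = k]).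
    by move=> k k' _ _ [w [[_ <-] [_ <-]]].
  rewrite [in LHS]BE ge0_integral_bigcup//; last 2 first.
  - by move=> k; exact: measurableI.
  - by move=> w _; rewrite lee_fin.
  rewrite [in RHS]BE setI_bigcupr measure_bigcup//; last 2 first.
  - by move=> k _; apply: measurableI => //; exact: measurableI.
  - by move=> k k' _ _ [w [[_ [_ <-]] [_ [_ <-]]]].
  under [RHS]eq_eseriesl do rewrite in_setT.
  by apply: eq_eseriesr => k _; exact: level.
have sigma_sat (B : set O) : <<s \bigcup_(k in [set k | (k <= t)%N]) events (S k) >> B ->
    forall w w', (forall u, (u <= t)%N -> S u w = S u w') -> B w -> B w'.
  by move=> sB w w' ww'; exact: path_sigma_saturated sB ww'.
exists g; split.
- move=> B _; apply: saturated_path_sigma => // w w' ww'.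
  by rewrite /preimage/= (gE _ _ ww').
(* Integrability is the identity at [B = setT]: the integral of the nonnegative [g] is a
   probability. *)
- apply/integrableP; split; first exact: mgB.
  under eq_integral do rewrite /= ger0_norm//.
  rewrite integral_g// setIT (le_lt_trans (probability_le1 _ _)) ?ltry//; exact: mS.
- by move=> B sB; apply: integral_g; exact: sigma_sat.
- apply: filterS ae_good => w [_ neqw].
  exact: (smbs_predictiveE m c F0 t j (T_gt0^~ w) neqw).
Qed.
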